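(* Let $\mathcal H$ be a complex separable Hilbert space, $\Sigma$ a Hausdorff, locally compact, $\sigma$-compact space endowed with a fixed Radon measure $\mu$, and $\pi:\Sigma\to\mathbb B(\mathcal H)$ a map such that: (a) $\int_\Sigma |\langle\pi(s)u,v\rangle|^2\,d\mu(s)=\|u\|^2\|v\|^2$ for all $u,v\in\mathcal H$; (b) $s\mapsto\pi(s)^*$ is strongly continuous; (c) the isometry $\Phi^\pi:\mathcal H\widehat\otimes\overline{\mathcal H}\to L^2(\Sigma)$ determined by $[\Phi^\pi(u\otimes v)](s)=\langle \pi(s)u,v\rangle$ is surjective; (d) $\pi(s_1)^*=1$ for some $s_1\in\Sigma$. Let $\mathscr K$ be a family of bounded operators in $\mathcal H$ and $\mathscr K^*:=\{S^*\mid S\in\mathscr K\}$. The following assertions are equivalent: 1. $\mathscr K$ is a relatively compact family (in the operator norm topology) of compact operators. 2. For some $w\in\mathcal H\setminus\{0\}$ (equivalently, for any $w\in\mathcal H$) the family $\{\phi^\pi_w(S\mathcal H_{[1]})\mid S\in\mathscr K\cup\mathscr K^*\}$ is uniformly tight in $L^2(\Sigma)$; this means that for every $\epsilon>0$ there exists a compact subset $L$ of $\Sigma$ such that $\sup_{S\in\mathscr K\cup\mathscr K^*}\|M_{\chi_L}^\perp\circ\phi^\pi_w\circ S\|_{\mathbb B(\mathcal H,L^2(\Sigma))}\le\epsilon$. 3. For every $\epsilon>0$ there exists $f\in C_{\rm c}(\Sigma)$ such that $\sup_{S\in\mathscr K\cup\mathscr K^*}\|[\Pi(f)-1]S\|_{\mathbb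 B(\mathcal H)}\le\epsilon$. 4. $\{\Sigma\ni s\mapsto\pi(s)^*S\in\mathbb B(\mathcal H)\mid S\in\mathscr K\cup\mathscr K^*\}$ is an equicontinuous family (for the operator norm on $\mathbb B(\mathcal H)$).
   Context: Inner products are linear in the first variable. $\mathbb B(\mathcal X,\mathcal Y)$ denotes the bounded linear operators from $\mathcal X$ to $\mathcal Y$, $\mathbb B(\mathcal H)=\mathbb B(\mathcal H,\mathcal H)$, $\overline{\mathcal H}$ is the conjugate Hilbert space of $\mathcal H$, $\mathcal H_{[1]}$ is the closed unit ball of $\mathcal H$, $\widehat\otimes$ is the Hilbert space tensor product, $L^2(\Sigma)=L^2(\Sigma;\mu)$, and $C_{\rm c}(\Sigma)$ is the space of continuous compactly supported complex functions on $\Sigma$. For $w\in\mathcal H$, $\phi^\pi_w:\mathcal H\to L^2(\Sigma)$ is defined by $[\phi^\pi_w(u)](s):=\langle\pi(s)u,w\rangle$. $M_{\chi_L}^\perp$ is the operator of multiplication by $1-\chi_L$ in $L^2(\Sigma)$, where $\chi_L$ is the characteristic function of $L$. Symbolic calculus: $\Pi:=\Lambda\circ(\Phi^\pi)^{-1}:L^2(\Sigma)\to\mathbb B_2(\mathcal H)$ (Hilbert-Schmidt operators), where $\Lambda:\mathcal H\widehat\otimes\overline{\mathcal H}\to\mathbb B_2(\mathcal H)$ is the unitary map determined by $\Lambda(u\otimes v)=\langle\cdot,v\rangle u$. Equivalently, in the weak sense, $\Pi(f)=\int_\Sigma f(s)\pi(s)^*\,d\mu(s)$.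
   Formalization: The family 𝒦 is additionally assumed bounded in operator norm, and the point s_1 with π(s_1)^*=1 is assumed to lie in the support of μ (which also excludes H={0}); the statement fails without these. *)

(* Defs.v *)
From HB Require Import structures.
From mathcomp Require Import all_boot all_order all_algebra.
From mathcomp Require Import complex.
From mathcomp Require Import all_classical all_reals all_analysis.
Import Order.TTheory GRing.Theory Num.Theory.
Import numFieldNormedType.Exports.

Set Implicit Arguments.
Unset Strict Implicit.
Unset Printing Implicit Defensive.

Local Open Scope classical_set_scope.
Local Open Scope complex_scope.
Local Open Scope ring_scope.

HB.mixin Record NormedModule_isHilbert (R : realType) T
    & NormedModule R[i] T := {
  inner : {dot T for @conjc R};
  inner_normE : forall u : T, inner u u = `|u| ^+ 2
}.

#[short(type="hilbertType")]
HB.structure Definition Hilbert (R : realType) :=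
  {T of CompleteNormedModule R[i] T & NormedModule_isHilbert R T}.

Notation "''[' u , v ]" := (inner u v) (format "''[' u ,  v ]") : ring_scope.

Definition conjugate (T : Type) : Type := T.

Section conjugate_normed.
Variables (R : realType) (V : normedModType R[i]).
HB.instance Definition _ := PseudoMetricNormedZmod.on (conjugate V).
Definition cscale (a : R[i]) (v : conjugate V) : conjugate V := conjc a *: (v : V).
Lemma cscaleA a b v : cscale a (cscale b v) = cscale (a * b) v.
Proof. by rewrite /cscale scalerA rmorphM. Qed.
Lemma cscale1 : left_id 1 cscale.
Proof. by move=> v; rewrite /cscale rmorph1 scale1r. Qed.
Lemma cscaleDr : right_distributive cscale +%R.
Proof. by move=> a u v; rewrite /cscale scalerDr. Qed.
Lemma cscaleDl v : {morph cscale^~ v : a b / a + b}.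
Proof. by move=> a b; rewrite /cscale rmorphD scalerDl. Qed.
HB.instance Definition _ := GRing.Zmodule_isLmodule.Build R[i] (conjugate V)
  cscaleA cscale1 cscaleDr cscaleDl.
Lemma cnormrZ (l : R[i]) (x : conjugate V) : `|l *: x| = `|l| * `|x|.
Proof.
transitivity (`|conjc l *: (x : V)|) => //.
rewrite normrZ; congr (_ * _).
by rewrite !normc_def; case: l => a b /=; rewrite sqrrN.
Qed.
HB.instance Definition _ :=
  PseudoMetricNormedZmod_Lmodule_isNormedModule.Build R[i] (conjugate V) cnormrZ.
End conjugate_normed.

Section conjugate_hilbert.
Variables (R : realType) (H : hilbertType R).
HB.instance Definition _ := Complete.on (conjugate H).
Definition cinner (u v : conjugate H) : R[i] := inner (v : H) (u : H).

Let cinnerDl v : zmod_morphism (cinner^~ v).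
Proof. by move=> a b; exact: (@zmod_morphismr_subproof _ _ _ _ _ _ (@inner R H)). Qed.
Let cinnerDr u : zmod_morphism (cinner u).
Proof. by move=> a b; exact: (@zmod_morphisml_subproof _ _ _ _ _ _ (@inner R H)). Qed.
Let cinnerZl v : scalable_for *%R (cinner^~ v).
Proof.
move=> a u; have /= := @linearr_subproof _ _ _ _ _ _ (@inner R H) v (conjc a) u.
by rewrite conjcK.
Qed.
Let cinnerZr u : scalable_for (@conjc R \; *%R) (cinner u).
Proof. move=> a v; exact: (@linearl_subproof _ _ _ _ _ _ (@inner R H) u (conjc a) v). Qed.
HB.instance Definition _ :=
  isBilinear.Build R[i] (conjugate H) (conjugate H) R[i] *%R (@conjc R \; *%R)
    cinner cinnerDl cinnerDr cinnerZl cinnerZr.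
Let cinnerC u v : cinner u v = (-1) ^+ false * conjc (cinner v u).
Proof. exact: (@hermitian_subproof _ _ _ _ (@inner R H)). Qed.
HB.instance Definition _ :=
  isHermitianSesquilinear.Build R[i] (conjugate H) false (@conjc R) cinner cinnerC.
Let cinner_gt0 u : u != 0 -> 0 < cinner u u.
Proof. exact: (@neq0_dnorm_gt0 _ _ _ (@inner R H)). Qed.
HB.instance Definition _ :=
  isDotProduct.Build R[i] (conjugate H) cinner cinner_gt0.
Let cinner_normE u : cinner u u = `|u| ^+ 2.
Proof. exact: (@inner_normE R H). Qed.
HB.instance Definition _ :=
  @NormedModule_isHilbert.Build R (conjugate H) cinner cinner_normE.
End conjugate_hilbert.

Section realnorm.
Context {R : realType} {V : normedZmodType R[i]}.
(* The norm of an R[i]-normed space takes its values in R[i]; rnorm x is the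
   same number as an element of R. *)
Definition rnorm (x : V) : R := complex.Re `|x|.
Lemma rnormE (x : V) : (rnorm x)%:C = `|x|.
Proof. apply: RRe_real; exact: ger0_real. Qed.
Lemma rnorm_ge0 (x : V) : 0 <= rnorm x.
Proof. rewrite -lecR rnormE; exact: normr_ge0. Qed.
Lemma rnormD (x y : V) : rnorm (x + y) <= rnorm x + rnorm y.
Proof. by rewrite -lecR rmorphD/= !rnormE ler_normD. Qed.
Lemma rnorm0_eq0 (x : V) : rnorm x = 0 -> x = 0.
Proof. by move=> x0; apply/normr0_eq0; rewrite -rnormE x0. Qed.
Lemma rnorm0 : rnorm (0 : V) = 0.
Proof. by rewrite /rnorm normr0. Qed.
End realnorm.

Definition closed_unit_ball (R : realType) (V : normedModType R[i]) : set V :=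
  [set x | rnorm x <= 1].
Arguments closed_unit_ball {R} V.

Section bounded_operators.
Context {R : realType}.
Implicit Types V W : normedModType R[i].
Lemma rnormZ V (a : R[i]) (x : V) : rnorm (a *: x) = rnorm a * rnorm x.
Proof.
by apply: complexI; rewrite rmorphM/= !rnormE normrZ.
Qed.

Definition bounded_linear V W : {pred V -> W} := fun f =>
  `[< linear f /\ exists M : R, forall x, rnorm (f x) <= M * rnorm x >].

Lemma bounded_linear_submod V W : submod_closed (@bounded_linear V W).
Proof.
split.
  apply/asboolP; split; first by move=> a x y /=; rewrite scaler0 addr0.
  by exists 0 => x; rewrite mul0r rnorm0.
move=> a f g /asboolP[fl [M fM]] /asboolP[gl [N gN]]; apply/asboolP; split.
  move=> b x y.
  change (a *: f (b *: x + y) + g (b *: x + y) =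
          b *: (a *: f x + g x) + (a *: f y + g y)).
  rewrite fl gl !scalerDr !scalerA [a * b]mulrC -!addrA; congr (_ + _).
  by rewrite addrCA.
exists (rnorm a * M + N) => x.
rewrite (le_trans (rnormD _ _))// mulrDl lerD//.
by rewrite rnormZ -mulrA ler_wpM2l// rnorm_ge0.
Qed.
HB.instance Definition _ V W :=
  GRing.isSubmodClosed.Build R[i] (V -> W) (@bounded_linear V W)
    (@bounded_linear_submod V W).

Record bop V W := BOp { bop_fun :> V -> W; bop_proof : bop_fun \in @bounded_linear V W }.
HB.instance Definition _ V W := [isSub of bop V W for @bop_fun V W].
HB.instance Definition _ V W := [Choice of bop V W by <:].
HB.instance Definition _ V W := [SubChoice_isSubLmodule of bop V W by <:].

Section opnorm.
Context {V W : normedModType R[i]}.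
Implicit Types A B : bop V W.

Definition opnorm A : R := sup [set rnorm (A x) | x in closed_unit_ball V].

Lemma bop_linear A : linear A.
Proof. by have /asboolP[] := bop_proof A. Qed.
Lemma bop0 A : A 0 = 0.
Proof.
have := bop_linear A 1 0 0; rewrite !scale1r addr0 => h.
by apply: (addrI (A 0)); rewrite addr0 -h.
Qed.
Lemma bopZ A a x : A (a *: x) = a *: A x.
Proof. by have := bop_linear A a x 0; rewrite bop0 !addr0. Qed.

Lemma opnorm_has_sup A :
  has_sup [set rnorm (A x) | x in closed_unit_ball V].
Proof.
split; first by exists (rnorm (A 0)), 0 => //; rewrite /closed_unit_ball/= rnorm0.
have /asboolP[_ [M AM]] := bop_proof A.
exists (`|M|) => _ [x x1 <-]; rewrite (le_trans (AM x))//.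
rewrite (le_trans (ler_wpM2r (rnorm_ge0 x) (ler_norm M)))//.
by rewrite -[leRHS]mulr1 ler_wpM2l.
Qed.
Lemma opnorm_ub A x : rnorm x <= 1 -> rnorm (A x) <= opnorm A.
Proof.
by move=> x1; apply: ub_le_sup; [case: (opnorm_has_sup A)|exists x].
Qed.
Lemma opnorm_le A (M : R) :
  (forall x, rnorm x <= 1 -> rnorm (A x) <= M) -> opnorm A <= M.
Proof.
move=> AM; apply: ge_sup; first by case: (opnorm_has_sup A).
by move=> _ [x x1 <-]; exact: AM.
Qed.
Lemma opnorm_ge0 A : 0 <= opnorm A.
Proof. by rewrite (le_trans (rnorm_ge0 (A 0)))// opnorm_ub// rnorm0. Qed.

Definition bop_norm A : R[i] := (opnorm A)%:C.
Lemma bop_normD A B : bop_norm (A + B) <= bop_norm A + bop_norm B.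
Proof.
rewrite /bop_norm -rmorphD lecR; apply: opnorm_le => x x1.
have -> : (A + B) x = A x + B x by [].
by rewrite (le_trans (rnormD _ _))// lerD// opnorm_ub.
Qed.
Lemma opnormZ_le (a : R[i]) A : opnorm (a *: A) <= rnorm a * opnorm A.
Proof.
apply: opnorm_le => x x1.
have -> : (a *: A) x = a *: A x by [].
by rewrite rnormZ ler_wpM2l ?rnorm_ge0// opnorm_ub.
Qed.
Lemma bop_normZ (a : R[i]) A : bop_norm (a *: A) = `|a| * bop_norm A.
Proof.
rewrite /bop_norm -rnormE -rmorphM; congr (_%:C).
apply/eqP; rewrite eq_le opnormZ_le/=.
have [->|a0] := eqVneq a 0; first by rewrite rnorm0 mul0r opnorm_ge0.
have ra0 : 0 < rnorm a.
  by rewrite lt_def rnorm_ge0 andbT; apply: contra_neq a0; exact: rnorm0_eq0.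
rewrite -ler_pdivlMl// (_ : (rnorm a)^-1 = rnorm a^-1); last first.
  by apply: complexI; rewrite fmorphV/= !rnormE normfV.
by rewrite (le_trans _ (opnormZ_le _ _))// scalerA mulVf// scale1r.
Qed.
Lemma bop_norm0_eq0 A : bop_norm A = 0 -> A = 0.
Proof.
move=> /(@complexI R _ 0) A0; apply: val_inj; apply/funext => x.
change (A x = 0).
have [->|x0] := eqVneq x 0; first exact: bop0.
have nx0 : `|x| != 0 by rewrite normr_eq0.
suff : A (`|x|^-1 *: x) = 0.
  rewrite bopZ => /eqP; rewrite scaler_eq0 invr_eq0 (negbTE nx0)/=.
  by move=> /eqP.
apply: rnorm0_eq0; apply/eqP; rewrite eq_le rnorm_ge0 andbT -A0.
apply: opnorm_ub; rewrite -lecR rnormE normrZ normfV normr_id mulVf//.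
Qed.
HB.instance Definition _ := @Lmodule_isNormed.Build R[i] (bop V W)
  bop_norm bop_normD bop_normZ bop_norm0_eq0.
End opnorm.

Lemma bop_comp_subproof (U V W : normedModType R[i]) (A : bop V W) (B : bop U V) :
  (A \o B) \in @bounded_linear U W.
Proof.
have /asboolP[Al [M AM]] := bop_proof A; have /asboolP[Bl [N BN]] := bop_proof B.
apply/asboolP; split; first by move=> a x y; rewrite /= Bl Al.
exists (`|M| * N) => x; rewrite (le_trans (AM _))// -mulrA.
by rewrite (le_trans (ler_wpM2r (rnorm_ge0 _) (ler_norm M)))// ler_wpM2l.
Qed.
Definition bop_comp U V W (A : bop V W) (B : bop U V) : bop U W :=
  BOp (bop_comp_subproof A B).

Lemma bop_id_subproof V : idfun \in @bounded_linear V V.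
Proof. by apply/asboolP; split => //; exists 1 => x; rewrite mul1r. Qed.
Definition bop_id V : bop V V := BOp (bop_id_subproof V).
End bounded_operators.

Notation "''B' ( V , W )" := (bop V W) (at level 8, format "''B' ( V ,  W )") : type_scope.
Notation "''B' ( V )" := (bop V V) (at level 8, format "''B' ( V )") : type_scope.
Notation "A \oB B" := (bop_comp A B) (at level 40, left associativity) : ring_scope.

(* By the Riesz representation theorem the adjoint exists, so that the default
   value 0 is never used. *)
Definition adjoint (R : realType) (H K : hilbertType R) (A : 'B(H, K)) : 'B(K, H) :=
  xget 0 [set B : 'B(K, H) | forall u v, '[A u, v] = '[u, B v]].

Definition compact_operator (R : realType) (V W : normedModType R[i])
    (A : 'B(V, W)) :=
  precompact (A @` closed_unit_ball V).

Definition separable (T : topologicalType) :=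
  exists2 D : set T, countable D & dense D.

(* The Hilbert space tensor product of H and K, characterized up to a unique
   unitary: a Hilbert space in which the elementary tensors are total and
   have the inner products <u,u'><v,v'>. *)
Record hilbert_tensor (R : realType) (H K : hilbertType R) := HilbertTensor {
  tensor_space :> hilbertType R;
  tens : {bilinear H -> K -> tensor_space};
  inner_tens : forall u u' v v', '[tens u v, tens u' v'] = '[u, u'] * '[v, v'];
  dense_tens :
    dense [set \sum_(p <- s) tens p.1 p.2 | s in [set: seq (H * K)]]
}.
Arguments tens {R H K} _.

(* Square of the Hilbert-Schmidt norm: by Bessel's inequality, the supremum
   over finite orthonormal families is the sum over any orthonormal basis. *)
Definition HS_norm2 (R : realType) (H K : hilbertType R) (A : 'B(H, K)) : \bar R :=
  ereal_sup [set (\sum_(e <- s) rnorm (A e) ^+ 2)%:E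
            | s in [set s : seq H | orthonormal inner s]].

Definition hilbert_schmidt (R : realType) (H K : hilbertType R) (A : 'B(H, K)) :=
  (HS_norm2 A < +oo)%E.

Section spaces_of_functions.
Context {R : realType}.

Definition sigma_compact (S : topologicalType) :=
  exists2 F : (set S)^nat, (forall n, compact (F n)) & \bigcup_n F n = [set: S].

Definition borel (S : ptopologicalType) := g_sigma_algebraType (@open S).

Section radon.
Variables (S : ptopologicalType) (mu : {measure set (borel S) -> \bar R}).

(* On a sigma-compact locally compact Hausdorff space the usual definitions of
   a Radon measure agree; this one asks for outer regularity on Borel sets and
   inner regularity on open sets. *)
Definition radon_measure :=
  [/\ forall L : set S, compact L -> (mu L < +oo)%E,
      forall A : set (borel S), measurable A ->
        mu A = ereal_inf [set mu U | U in [set U : set S | open U /\ A `<=` U]] &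
      forall U : set S, open U ->
        mu U = ereal_sup [set mu L | L in [set L : set S | compact L /\ L `<=` U]]].

Definition measure_support : set S :=
  [set s | forall U : set S, open U -> U s -> (0 < mu U)%E].
End radon.

Section L2.
Context d (T : measurableType d) (mu : {measure set T -> \bar R}).
Implicit Types f : T -> R[i].

Definition L2norm f : \bar R := 'N[mu]_2%:E[EFin \o (fun s => rnorm (f s))].

(* Elements of L^2 are represented by functions, to be compared almost
   everywhere. *)
Definition L2 : set (T -> R[i]) :=
  [set f | [/\ measurable_fun setT (fun s => complex.Re (f s)),
               measurable_fun setT (fun s => complex.Im (f s)) &
               (L2norm f < +oo)%E]].

Definition L2_opnorm (V : normedModType R[i]) (A : V -> T -> R[i]) : \bar R :=
  ereal_sup [set L2norm (A u) | u in closed_unit_ball V].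
End L2.

Definition Cc (S : topologicalType) : set (S -> R[i]) :=
  [set f | continuous (f : S -> R[i]^o) /\
           compact (closure [set s | f s != 0])].

(* Multiplication by 1 - chi_L. *)
Definition restr_compl (T : Type) (L : set T) (f : T -> R[i]) : T -> R[i] :=
  fun s => (1 - \1_L s)%:C * f s.
End spaces_of_functions.

Section calculus.
Context {R : realType} {H : hilbertType R} {Sigma : ptopologicalType}.
Variables (mu : {measure set (borel Sigma) -> \bar R}) (pi : Sigma -> 'B(H)).
Variable HH : hilbert_tensor H (conjugate H).
Implicit Types (K : set 'B(H)) (w : H).

Definition phi w (u : H) : Sigma -> R[i] := fun s => '[pi s u, w].

(* The clauses are up to null sets because Phi takes its values in functions
   and not in classes of functions. *)
Definition is_Phi (Phi : HH -> Sigma -> R[i]) :=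
  [/\ forall t, L2 mu (Phi t),
      forall (a : R[i]) t t',
        {ae mu, forall s, Phi (a *: t + t') s = a * Phi t s + Phi t' s},
      forall t, L2norm mu (Phi t) = (rnorm t)%:E &
      forall u v : H, {ae mu, forall s, Phi (tens HH u v) s = phi v u s}].

Definition L2_surjective (Phi : HH -> Sigma -> R[i]) :=
  forall f, L2 mu f -> exists t, {ae mu, forall s, Phi t s = f s}.

Definition is_Lambda (Lambda : {linear HH -> 'B(H)}) :=
  [/\ forall u v x : H, Lambda (tens HH u v) x = '[x, v] *: u,
      forall t, HS_norm2 (Lambda t) = (rnorm t ^+ 2)%:E &
      forall A : 'B(H), hilbert_schmidt A -> exists t, Lambda t = A].

(* Lambda composed with the inverse of Phi: the preimage of f is unique since
   Phi is isometric, and 0 is used only if f is not in the range of Phi. *)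
Definition Pi (Phi : HH -> Sigma -> R[i]) (Lambda : HH -> 'B(H))
    (f : Sigma -> R[i]) : 'B(H) :=
  Lambda (xget 0 [set t | {ae mu, forall s, Phi t s = f s}]).

Definition with_adjoints K : set 'B(H) := K `|` @adjoint R H H @` K.

Definition uniformly_tight w K :=
  forall eps : R, 0 < eps -> exists2 L : set Sigma, compact L &
    (ereal_sup [set L2_opnorm mu (fun u => restr_compl L (phi w (S u))) | S in K]
      <= eps%:E)%E.
End calculus.

(* Main.v *)
From HB Require Import structures.
Require Import Defs.
From mathcomp Require Import all_boot all_order all_algebra.
From mathcomp Require Import complex finmap.
From mathcomp Require Import all_classical all_reals all_analysis.
From mathcomp Require Import measurable_realfun ring lra.
Import Order.TTheory GRing.Theory Num.Theory.
Import numFieldNormedType.Exports.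

Set Implicit Arguments.
Unset Strict Implicit.
Unset Printing Implicit Defensive.

Local Open Scope classical_set_scope.
Local Open Scope complex_scope.
Local Open Scope ring_scope.

(** All conditions are compared with a single one on the set X of the vectors S u,
    where S ranges over K and the adjoints of its members and |u| <= 1: X has
    finite nets. Since K is bounded, this means that X is nearly
    finite-dimensional: for each e there is an orthogonal projection P of finite
    rank with |x - P x| <= e for all x in X (totally_bounded_nearly_finite_dim,
    nearly_finite_dim_totally_bounded).

    Compactness. If K is relatively compact and consists of compact operators,
    finitely many of its members S, together with their adjoints, approximate all
    of them, and S^* is compact with S (totally_bounded_adjoint). Conversely, if P
    nearly fixes the images of both S and S^*, then S is close to P S P, which
    varies in a bounded part of a finite-dimensional space of operators
    (totally_bounded_images_precompact).

    Tightness. The coefficient functions of finitely many vectors have small L^2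
    mass outside some compact set, so finite nets give tightness
    (totally_bounded_tight). Conversely, let L be the compact set given by
    tightness. The vectors pi(s)^* w with s in L form a compact set, so they are
    nearly fixed by a finite-rank projection P. For x in X and v = x - P x the
    coefficient <pi(s) v, w> is small on L and <pi(s) x, w> is small off L; but the
    inner product of these two functions in L^2 is <x, v> |w|^2 = |v|^2 |w|^2, so v
    is small (tight_nearly_finite_dim).

    Symbolic calculus. Lambda and Phi identify L^2 with the Hilbert-Schmidt
    operators isometrically. A finite-rank projection therefore is Pi of a square
    integrable function, and this function can be cut off to a compact set
    (nearly_finite_dim_symbol); conversely Pi f is always a norm limit of operators
    of finite rank (symbol_nearly_finite_dim).

    Equicontinuity. The norms of pi(s)^* are locally bounded by the uniform
    boundedness principle, so finite nets give equicontinuity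
    (totally_bounded_equicontinuous). Conversely, near the point s1 with
    pi(s1)^* = 1 equicontinuity makes pi(s)^* almost the identity on X; so is its
    average over a small neighbourhood of positive measure, and this average is
    Hilbert-Schmidt (equicontinuous_nearly_finite_dim).

    The vector w of the second condition can be chosen nonzero because L^2, and
    with it the tensor product, is nonzero near s1 (nontrivial_space). Inner
    products in L^2 are always evaluated through squared norms of differences,
    which reduces the integration theory to nonnegative functions. *)

(** * Finite nets in complex normed spaces *)

Section normed.
Context {R : realType}.
Implicit Types V W : normedModType R[i].

Lemma rnormN (V : normedZmodType R[i]) (x : V) : rnorm (- x) = rnorm x.
Proof. by rewrite /rnorm normrN. Qed.

Lemma rdistC (V : normedZmodType R[i]) (x y : V) : rnorm (x - y) = rnorm (y - x).
Proof. by rewrite -rnormN opprB. Qed.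

Lemma rdist_triangle (V : normedZmodType R[i]) (z x y : V) :
  rnorm (x - y) <= rnorm (x - z) + rnorm (z - y).
Proof. by rewrite (le_trans _ (rnormD _ _))// addrA subrK. Qed.

Lemma ler_rdist (V : normedZmodType R[i]) (x y : V) : rnorm x - rnorm y <= rnorm (x - y).
Proof. by rewrite lerBlDr (le_trans _ (rnormD _ _))// subrK. Qed.

Lemma rnorm_lt (V : normedZmodType R[i]) (x : V) (e : R) : (`|x| < e%:C) = (rnorm x < e).
Proof. by rewrite -rnormE ltcR. Qed.

Lemma rnorm_le (V : normedZmodType R[i]) (x : V) (e : R) : (`|x| <= e%:C) = (rnorm x <= e).
Proof. by rewrite -rnormE lecR. Qed.

Lemma posC_exists (e : R[i]) : 0 < e -> exists2 r : R, 0 < r & e = r%:C.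
Proof.
move=> e0; have er : e \is Num.real by exact: gtr0_real.
by exists (complex.Re e); rewrite ?RRe_real// -ltcR RRe_real.
Qed.

Lemma nbhs_rnormP V (x : V) (A : set V) :
  nbhs x A <-> exists2 e : R, 0 < e & forall y, rnorm (x - y) < e -> A y.
Proof.
split.
  move=> /nbhs_normP[_ /posC_exists[e e0 ->] xA]; exists e => // y xy.
  by apply: xA; rewrite /= rnorm_lt.
move=> [e e0 xA]; apply/nbhs_normP; exists e%:C; first by rewrite /= ltcR.
by move=> y /=; rewrite rnorm_lt; exact: xA.
Qed.

Lemma ball_rnorm V (x y : V) (e : R) : ball x e%:C y = (rnorm (x - y) < e).
Proof. by rewrite -rnorm_lt -ball_normE. Qed.

(** Precompact means that the closure is compact; in a complete space this is
    the existence of finite nets, the form in which compactness is produced and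
    consumed below. *)
Definition totally_bounded V (X : set V) :=
  forall e : R, 0 < e -> exists l : seq V,
    forall x, X x -> exists2 a, a \in l & rnorm (x - a) < e.

Lemma precompact_totally_bounded V (X : set V) :
  precompact X -> totally_bounded X.
Proof.
move=> [U XU [+ _]] e e0; rewrite compact_cover.
move=> /(_ V setT (fun a => ball a e%:C)) [a _||l _ Ul].
- exact: ball_open.
- by move=> x Ux; exists x => //; rewrite ball_rnorm subrr rnorm0.
exists (enum_fset l) => x Xx; have [a al] := Ul _ (XU _ Xx).
by rewrite ball_rnorm rdistC; exists a.
Qed.

Lemma ultra_finite_cover (T : Type) (I : eqType) (F : set_system T) (l : seq I)
    (B : I -> set T) (X : set T) : UltraFilter F -> F X ->
  (forall x, X x -> exists2 i, i \in l & B i x) ->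
  exists2 i, i \in l & F (B i).
Proof.
move=> FU; elim: l X => [|a l IH] X FX XB.
  have [x Xx] := filter_ex FX; by have [] := XB x Xx.
have [FB|FB] := in_ultra_setVsetC (B a) FU.
  by exists a => //; rewrite mem_head.
have [||i il FBi] := IH (X `&` ~` B a); first exact: filterI.
  move=> x [Xx nBx]; have [j] := XB x Xx; rewrite inE => /orP[/eqP->//|jl Bj].
  by exists j.
by exists i => //; rewrite inE il orbT.
Qed.

(** An ultrafilter on a set with finite nets contains arbitrarily small balls,
    hence is Cauchy. *)
Lemma totally_bounded_precompact (V : completeNormedModType R[i]) (X : set V) :
  totally_bounded X -> precompact X.
Proof.
move=> Xtb; rewrite precompactE compact_ultra => F FU FX.
have FP : ProperFilter F by exact: ultra_proper.
have : cauchy F.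
  apply: cauchy_exP => _ /posC_exists[e e0 ->].
  have e20 : 0 < e / 2 by rewrite divr_gt0.
  have [l Xl] := Xtb _ e20.
  have [|i _ Fi] := @ultra_finite_cover V V F l (fun a => ball a e%:C) _ FU FX.
    move=> x /(_ (ball x (e / 2)%:C))[].
      by apply: nbhsx_ballx; rewrite ltcR.
    move=> y [Xy]; rewrite ball_rnorm => xy.
    have [a al ya] := Xl _ Xy; exists a => //.
    rewrite ball_rnorm (le_lt_trans (rdist_triangle y _ _))// (splitr e) ltrD//.
      by rewrite rdistC.
    by rewrite rdistC.
  by exists i.
move=> /cauchy_cvg /cvg_ex[/= x Fx]; exists x; split => //.
apply: (@closed_closure _ X) => B xB.
by apply: (@filter_ex _ F); apply: filterI => //; exact: (Fx B xB).
Qed.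

Lemma sub_totally_bounded V (X Y : set V) :
  X `<=` Y -> totally_bounded Y -> totally_bounded X.
Proof.
move=> XY Ytb e /Ytb[l Yl]; exists l => x /XY; exact: Yl.
Qed.

(** The points of a net can be moved into the set if the radius is doubled. *)
Lemma totally_bounded_inner V (X : set V) : totally_bounded X ->
  forall e : R, 0 < e -> exists2 l : seq V, {in l, forall a, X a} &
    forall x, X x -> exists2 a, a \in l & rnorm (x - a) < e.
Proof.
move=> Xtb e e0; have [|l Xl] := Xtb (e / 2); first by rewrite divr_gt0.
have : forall a : V, exists b : V, (exists x, X x /\ rnorm (x - a) < e / 2) ->
    X b /\ rnorm (b - a) < e / 2.
  move=> a; have [[x xa]|] := pselect (exists x, X x /\ rnorm (x - a) < e / 2).
    by exists x.
  by exists 0.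
move=> /choice[b bP].
exists [seq b a | a <- l & `[<exists x, X x /\ rnorm (x - a) < e / 2>]].
  by move=> _ /mapP[a + ->]; rewrite mem_filter => /andP[/asboolP/bP[]].
move=> x Xx; have [a al xa] := Xl _ Xx; exists (b a).
  by apply: map_f; rewrite mem_filter al andbT; apply/asboolP; exists x.
have /bP[_ ba] : exists x, X x /\ rnorm (x - a) < e / 2 by exists x.
rewrite (le_lt_trans (rdist_triangle a _ _))// (splitr e) ltrD//.
by rewrite rdistC.
Qed.

Lemma totally_bounded_close V (X : set V) :
  (forall e : R, 0 < e -> exists2 Y, totally_bounded Y &
     forall x, X x -> exists2 y, Y y & rnorm (x - y) <= e) ->
  totally_bounded X.
Proof.
move=> XY e e0; have e20 : 0 < e / 2 by rewrite divr_gt0.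
have [Y Ytb Yx] := XY _ e20; have [l Yl] := Ytb _ e20; exists l => x /Yx[y Yy xy].
have [a al ya] := Yl _ Yy; exists a => //.
by rewrite (le_lt_trans (rdist_triangle y _ _))// (splitr e) ler_ltD.
Qed.

Lemma totally_bounded_bounded V (X : set V) : totally_bounded X ->
  exists2 M : R, 0 <= M & forall x, X x -> rnorm x <= M.
Proof.
move=> /(_ _ ltr01)[l Xl].
suff [M M0 lM] : exists2 M : R, 0 <= M & {in l, forall a, rnorm a <= M}.
  exists (M + 1); first by rewrite addr_ge0.
  move=> x /Xl[a al xa]; rewrite -(subrK a x) addrC (le_trans (rnormD _ _))//.
  by rewrite lerD ?lM// ltW.
elim: l {Xl} => [|a l [M M0 lM]]; first by exists 0.
exists (rnorm a + M); first by rewrite addr_ge0// rnorm_ge0.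
move=> b; rewrite inE => /orP[/eqP->|/lM bM]; first by rewrite lerDl.
by rewrite (le_trans bM)// lerDr rnorm_ge0.
Qed.

Lemma totally_bounded_interval (M e : R) : 0 <= M -> 0 < e ->
  exists l : seq R, forall x, `|x| <= M -> exists2 a, a \in l & `|x - a| < e.
Proof.
move=> M0 e0.
exists [seq e * (i%:R) - M | i <- iota 0 (Num.truncn (2 * M / e)).+1] => x xM.
have xM0 : 0 <= (x + M) / e by move: xM; rewrite ler_norml => /andP[? ?]; rewrite divr_ge0//; [lra|exact: ltW].
exists (e * (Num.truncn ((x + M) / e))%:R - M).
  apply: (map_f (fun i : nat => e * i%:R - M)); rewrite mem_iota /= add0n ltnS.
  apply: le_truncn; rewrite ler_pM2r ?invr_gt0//; move: xM; rewrite ler_norml => /andP[]; lra.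
have /andP[] := truncn_itv xM0.
rewrite ler_pdivlMr// ltr_pdivrMr// -[_.+1%:R]natr1 => h1 h2.
by rewrite ltr_norml; apply/andP; split; lra.
Qed.

Lemma totally_bounded_disk (M e : R) : 0 <= M -> 0 < e ->
  exists l : seq R[i], forall z : R[i], rnorm z <= M ->
    exists2 a, a \in l & rnorm (z - a) < e.
Proof.
move=> M0 e0; have e20 : 0 < e / 2 by rewrite divr_gt0.
have [l Ml] := totally_bounded_interval M0 e20.
have RM (z : R[i]) : `|complex.Re z| <= rnorm z.
  by rewrite -lecR rnormE normc_ge_Re.
have IM (z : R[i]) : `|complex.Im z| <= rnorm z.
  have := RM (z * 'i); rewrite ReiNIm normrN => /le_trans; apply.
  by rewrite -lecR !rnormE normrM normCi mulr1.
have RIM (x y : R) : rnorm (x +i* y) <= `|x| + `|y|.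
  rewrite -lecR rnormE rmorphD/= (_ : x +i* y = x%:C + 'i * y%:C); last first.
    by rewrite {1}(complexE (x +i* y)).
  rewrite (le_trans (ler_normD _ _))// normrM normCi mul1r !normc_def/=.
  by rewrite !expr0n/= !addr0 !sqrtr_sqr.
exists [seq x +i* y | x <- l, y <- l] => -[x y] zM.
have [a al xa] := Ml _ (le_trans (RM _) zM).
have [b bl yb] := Ml _ (le_trans (IM _) zM).
exists (a +i* b); first exact: allpairs_f.
by rewrite (le_lt_trans (RIM _ _))// (splitr e) ltrD.
Qed.

Lemma totally_bounded_add_line V (X : set V) (e : V) (M : R) :
  0 <= M -> totally_bounded X ->
  totally_bounded [set x + c *: e | x in X & c in [set c : R[i] | rnorm c <= M]].
Proof.
move=> M0 Xtb d d0; have d20 : 0 < d / 2 by rewrite divr_gt0.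
have [l Xl] := Xtb _ d20.
have ne : 0 < rnorm e + 1 by rewrite ltr_wpDl// rnorm_ge0.
have [|m Mm] := @totally_bounded_disk M (d / 2 / (rnorm e + 1)) M0.
  by rewrite divr_gt0.
exists [seq a + b *: e | a <- l, b <- m] => _ [x Xx [c cM <-]].
have [a al xa] := Xl _ Xx; have [b bm cb] := Mm _ cM.
exists (a + b *: e); first exact: (allpairs_f (fun a b => a + b *: e)).
rewrite opprD addrACA -scalerBl (le_lt_trans (rnormD _ _))// (splitr d) ltrD//.
rewrite rnormZ (le_lt_trans (y := rnorm (c - b) * (rnorm e + 1)))//.
  by rewrite ler_wpM2l// ?rnorm_ge0// lerDl.
by rewrite -ltr_pdivlMr.
Qed.

(** Bounded parts of finite-dimensional spaces: one bounded coordinate is added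
    at a time, each with a net of a disk. *)
Lemma totally_bounded_combination V (I : Type) (s : seq I) (E : I -> V) (M : R) :
  0 <= M ->
  totally_bounded [set \sum_(i <- s) c i *: E i |
    c in [set c : I -> R[i] | forall i, rnorm (c i) <= M]].
Proof.
move=> M0; elim: s => [|i s IH].
  by move=> e e0; exists [:: 0] => _ [c _ <-]; exists 0; rewrite ?mem_head// big_nil subrr rnorm0.
apply: sub_totally_bounded (totally_bounded_add_line (E i) M0 IH) => _ [c cM <-].
exists (\sum_(i <- s) c i *: E i); first by exists c.
by exists (c i); [exact: cM|rewrite big_cons addrC].
Qed.

End normed.

(** * Bounded operators *)

Section operators.
Context {R : realType}.
Implicit Types V W : normedModType R[i].

Lemma bop_le V W (A : 'B(V, W)) x : rnorm (A x) <= rnorm A * rnorm x.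
Proof.
have [->|x0] := eqVneq x 0; first by rewrite bop0 !rnorm0 mulr0.
have nx : 0 < rnorm x.
  by rewrite lt_def rnorm_ge0 andbT; apply: contra_neq x0; exact: rnorm0_eq0.
rewrite -ler_pdivrMr// mulrC.
have nV : rnorm ((rnorm x)^-1%:C) = (rnorm x)^-1.
  by apply: complexI; rewrite rnormE ger0_norm// ler0c invr_ge0 ltW.
rewrite -nV -rnormZ -bopZ; apply: opnorm_ub.
by rewrite rnormZ nV mulVf// gt_eqF.
Qed.

Lemma bop_le_ball V W (A : 'B(V, W)) x : rnorm x <= 1 -> rnorm (A x) <= rnorm A.
Proof. exact: opnorm_ub. Qed.

Lemma rnorm_bop_le V W (A : 'B(V, W)) (M : R) :
  (forall x, rnorm x <= 1 -> rnorm (A x) <= M) -> rnorm A <= M.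
Proof. exact: opnorm_le. Qed.

Lemma rnorm_bop_le_scale V W (A : 'B(V, W)) (M : R) : 0 <= M ->
  (forall x, rnorm (A x) <= M * rnorm x) -> rnorm A <= M.
Proof.
move=> M0 AM; apply: rnorm_bop_le => x x1; rewrite (le_trans (AM x))//.
by rewrite -[leRHS]mulr1 ler_wpM2l.
Qed.

Lemma bopD V W (A : 'B(V, W)) x y : A (x + y) = A x + A y.
Proof. by have := bop_linear A 1 x y; rewrite !scale1r. Qed.

Lemma bopN V W (A : 'B(V, W)) x : A (- x) = - A x.
Proof. by rewrite -scaleN1r bopZ scaleN1r. Qed.

Lemma bopB V W (A : 'B(V, W)) x y : A (x - y) = A x - A y.
Proof. by rewrite bopD bopN. Qed.

Lemma bop_sum V W (A : 'B(V, W)) (I : Type) (s : seq I) (F : I -> V) :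
  A (\sum_(i <- s) F i) = \sum_(i <- s) A (F i).
Proof. exact: (big_morph A (bopD A) (bop0 A)). Qed.

Lemma bop_subE V W (A B : 'B(V, W)) x : (A - B) x = A x - B x.
Proof. by []. Qed.

Lemma bopP V W (A B : 'B(V, W)) : A =1 B -> A = B.
Proof. by move=> AB; apply: val_inj; exact/funext. Qed.

Lemma sum_bopE V W (I : Type) (s : seq I) (F : I -> 'B(V, W)) x :
  (\sum_(i <- s) F i) x = \sum_(i <- s) F i x.
Proof. exact: (big_morph (fun A : 'B(V, W) => A x)). Qed.

Section make.
Variables (V W : normedModType R[i]) (f : V -> W).
Hypothesis fl : linear f.
Hypothesis fb : exists M : R, forall x, rnorm (f x) <= M * rnorm x.
Lemma make_bop_proof : f \in @bounded_linear R V W.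
Proof. by apply/asboolP. Qed.
Definition make_bop : 'B(V, W) := BOp make_bop_proof.
End make.

Lemma cvg_rnormP V (T : Type) (F : set_system T) (f : T -> V) (x : V) :
  Filter F -> f @ F --> x <->
  forall e : R, 0 < e -> \forall t \near F, rnorm (x - f t) < e.
Proof.
move=> FF; split.
  move=> Fx e e0; apply: (Fx [set y | rnorm (x - y) < e]).
  by apply/nbhs_rnormP; exists e.
move=> Fx A /nbhs_rnormP[e e0 xA].
by apply: filterS (Fx _ e0) => t; exact: xA.
Qed.

Section complete.
Variables (V : normedModType R[i]) (W : completeNormedModType R[i]).

(** A Cauchy filter of operators converges at each point; uniformity on the unit
    ball comes from the Cauchy condition, as for uniform convergence. *)
Lemma bop_complete (F : set_system 'B(V, W)) :
  ProperFilter F -> cauchy F -> cvg F.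
Proof.
move=> FF /cauchyP Fc.
have Fce (e : R) : 0 < e -> exists A, F [set B | rnorm (A - B) < e].
  move=> e0; have [|A FA] := Fc e%:C; first by rewrite ltcR.
  by exists A; apply: filterS FA => B; rewrite ball_rnorm.
have [A Ax] : {A : V -> W & forall x, (fun S : 'B(V, W) => S x) @ F --> A x}.
  apply: (@choice _ _ (fun x y => (fun S : 'B(V, W) => S x) @ F --> y)) => x.
  apply/cvg_ex; apply: cauchy_cvg; apply: cauchy_exP => _ /posC_exists[e e0 ->].
  have x1 : 0 < rnorm x + 1 by rewrite ltr_wpDl// rnorm_ge0.
  have [|S FS] := Fce (e / (rnorm x + 1)); first by rewrite divr_gt0.
  exists (S x); change (F [set T : 'B(V, W) | ball (S x) e%:C (T x)]).
  apply: filterS FS => T ST; rewrite /mkset ball_rnorm -bop_subE (le_lt_trans (bop_le _ _))//.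
  rewrite (le_lt_trans (y := rnorm (S - T) * (rnorm x + 1)))//.
    by rewrite ler_wpM2l ?rnorm_ge0// lerDl.
  by rewrite -ltr_pdivlMr.
have Al : linear A.
  move=> c x y; apply: (@cvg_unique _ (@norm_hausdorff _ W) _ _ _ _ (Ax _)).
  rewrite (_ : (fun S : 'B(V, W) => S (c *: x + y)) =
               (fun S : 'B(V, W) => c *: S x + S y)); last first.
    by apply/funext => S; rewrite bop_linear.
  by apply: cvgD => //; apply: cvgZr; exact: Ax.
have FA (e : R) : 0 < e ->
    \forall S \near F, forall x, rnorm (A x - (S : 'B(V, W)) x) <= e * rnorm x.
  move=> e0; have e20 : 0 < e / 2 by rewrite divr_gt0.
  have [B FB] := Fce _ e20; have FB' := FB; apply: filterS FB' => S BS x.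
  apply/ler_addgt0Pr => d d0.
  have xd : \forall T \near F, rnorm (A x - (T : 'B(V, W)) x) < d.
    by move: d d0; apply/cvg_rnormP; exact: Ax.
  have [T [Tx BT]] : exists T : 'B(V, W), rnorm (A x - T x) < d /\ rnorm (B - T) < e / 2.
    by apply: (@filter_ex _ F); exact: (@filterI _ F _ _ _ xd FB).
  rewrite (le_trans (rdist_triangle (T x) _ _))// [leRHS]addrC lerD//.
    exact: ltW.
  rewrite -bop_subE (le_trans (bop_le _ _))// ler_wpM2r ?rnorm_ge0//.
  by rewrite (le_trans (rdist_triangle B _ _))// (splitr e) lerD// ltW// rdistC.
have Ab : exists M : R, forall x, rnorm (A x) <= M * rnorm x.
  have [S SA] := filter_ex (FA _ ltr01).
  exists (1 + rnorm S) => x; rewrite -(subrK (S x) (A x)) (le_trans (rnormD _ _))//.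
  by rewrite mulrDl lerD// bop_le.
apply/cvg_ex; exists (make_bop Al Ab) => B /nbhs_rnormP[e e0 AB].
have e20 : 0 < e / 2 by rewrite divr_gt0.
rewrite nbhs_simpl; apply: filterS (FA _ e20) => S SA; apply: AB.
rewrite (le_lt_trans (y := e / 2))//; last by lra.
by apply: rnorm_bop_le_scale; [exact: ltW|exact: SA].
Qed.

HB.instance Definition _ := Uniform_isComplete.Build 'B(V, W) bop_complete.
End complete.

End operators.


(** * Inner products, the Riesz representation and adjoints *)

Section complex_modulus.
Context {R : realType}.
Implicit Types z w : R[i].

Lemma rnormM z w : rnorm (z * w) = rnorm z * rnorm w.
Proof. by apply: complexI; rewrite rmorphM/= !rnormE normrM. Qed.

Lemma rnormR (x : R) : rnorm (x%:C) = `|x|.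
Proof. by apply: complexI; rewrite rnormE normc_def/= expr0n/= addr0 sqrtr_sqr. Qed.

Lemma rnorm_complex_sqr z :
  rnorm z ^+ 2 = complex.Re z ^+ 2 + complex.Im z ^+ 2.
Proof. by apply: complexI; rewrite add_Re2_Im2 rmorphXn/= rnormE. Qed.

Lemma ler_Re_rnorm z : `|complex.Re z| <= rnorm z.
Proof. by rewrite -lecR rnormE normc_ge_Re. Qed.

Lemma Re_le_rnorm z : complex.Re z <= rnorm z.
Proof. exact: le_trans (ler_norm _) (ler_Re_rnorm z). Qed.

Lemma ReD z w : complex.Re (z + w) = complex.Re z + complex.Re w.
Proof. by case: z; case: w. Qed.

Lemma ReN z : complex.Re (- z) = - complex.Re z.
Proof. by case: z. Qed.

Lemma ReB z w : complex.Re (z - w) = complex.Re z - complex.Re w.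
Proof. by rewrite ReD ReN. Qed.

Lemma ReJ z : complex.Re (conjc z) = complex.Re z.
Proof. by case: z. Qed.

Lemma ReZ (x : R) z : complex.Re (x%:C * z) = x * complex.Re z.
Proof. by case: z => a b /=; rewrite mul0r subr0. Qed.

Lemma rnorm_eq0 (V : normedModType R[i]) (x : V) : (rnorm x == 0) = (x == 0).
Proof. by apply/eqP/eqP => [/rnorm0_eq0//|->]; rewrite rnorm0. Qed.

Lemma rnorm_gt0 (V : normedModType R[i]) (x : V) : x != 0 -> 0 < rnorm x.
Proof. by move=> x0; rewrite lt_def rnorm_ge0 andbT rnorm_eq0. Qed.

End complex_modulus.

Section inner_product.
Context {R : realType} {H : hilbertType R}.
Implicit Types u v w x : H.

Lemma innerC u v : '[u, v] = conjc '[v, u].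
Proof. by rewrite (@hermitian_subproof _ _ _ _ (@inner R H)) expr0 mul1r. Qed.

Lemma innerDl u v w : '[u + v, w] = '[u, w] + '[v, w].
Proof. exact: linearDl. Qed.
Lemma innerDr u v w : '[u, v + w] = '[u, v] + '[u, w].
Proof. exact: linearDr. Qed.
Lemma innerNr u v : '[u, - v] = - '[u, v].
Proof. exact: linearNr. Qed.
Lemma innerBl u v w : '[u - v, w] = '[u, w] - '[v, w].
Proof. exact: linearBl. Qed.
Lemma innerBr u v w : '[u, v - w] = '[u, v] - '[u, w].
Proof. exact: linearBr. Qed.
Lemma inner0l u : '[0, u] = 0.
Proof. exact: linear0l. Qed.
Lemma inner0r u : '[u, 0] = 0.
Proof. exact: linear0r. Qed.
Lemma innerZl c u v : '[c *: u, v] = c * '[u, v].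
Proof. exact: (@linearl_subproof _ _ _ _ _ _ (@inner R H)). Qed.
Lemma innerZr c u v : '[u, c *: v] = conjc c * '[u, v].
Proof. exact: (@linearr_subproof _ _ _ _ _ _ (@inner R H)). Qed.
Lemma inner_suml (I : Type) (s : seq I) (F : I -> H) v :
  '[\sum_(i <- s) F i, v] = \sum_(i <- s) '[F i, v].
Proof. exact: (big_morph (fun u => '[u, v]) (fun u w => innerDl u w v) (inner0l v)). Qed.

Lemma inner_rnorm u : '[u, u] = (rnorm u ^+ 2)%:C.
Proof. by rewrite inner_normE rmorphXn/= rnormE. Qed.

Lemma rnorm_sqr u : rnorm u ^+ 2 = complex.Re '[u, u].
Proof. by rewrite inner_rnorm. Qed.

Lemma rnormD_sqr u v :
  rnorm (u + v) ^+ 2 = rnorm u ^+ 2 + rnorm v ^+ 2 + complex.Re '[u, v] *+ 2.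
Proof.
rewrite !rnorm_sqr innerDl !innerDr !ReD [in X in _ + (X + _)]innerC ReJ; ring.
Qed.

Lemma rnormB_sqr u v :
  rnorm (u - v) ^+ 2 = rnorm u ^+ 2 + rnorm v ^+ 2 - complex.Re '[u, v] *+ 2.
Proof. by rewrite rnormD_sqr rnormN innerNr ReN mulNrn. Qed.

Lemma parallelogram u v :
  rnorm (u + v) ^+ 2 + rnorm (u - v) ^+ 2 = 2 * (rnorm u ^+ 2 + rnorm v ^+ 2).
Proof. rewrite rnormD_sqr rnormB_sqr; ring. Qed.

Lemma cauchy_schwarz u v : rnorm '[u, v] <= rnorm u * rnorm v.
Proof.
have [->|v0] := eqVneq v 0; first by rewrite inner0r !rnorm0 mulr0.
have nv := rnorm_gt0 v0.
(* The component of |v|^2 u orthogonal to v; scaling by |v|^2 avoids division. *)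
have := sqr_ge0 (rnorm (((rnorm v ^+ 2)%:C) *: u - '[u, v] *: v)).
rewrite rnormB_sqr !rnormZ innerZl innerZr ReZ.
set c := '[u, v]; have -> : complex.Re (conjc c * c) = rnorm c ^+ 2.
  by rewrite rnorm_complex_sqr; case: (c) => a b /=; ring.
rewrite rnormR ger0_norm ?sqr_ge0//.
move: (rnorm c) (rnorm_ge0 c) (rnorm u) (rnorm_ge0 u) (rnorm v) nv => {c v0}.
move=> c c0 a a0 b b0 h.
have : 0 <= b ^+ 2 * ((a * b) ^+ 2 - c ^+ 2) by rewrite (le_trans h)// le_eqVlt; apply/orP; left; apply/eqP; ring.
rewrite pmulr_rge0 ?exprn_gt0// subr_ge0 ler_pXn2r// nnegrE//.
by rewrite mulr_ge0// ltW.
Qed.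

Lemma innerI u v : (forall x, '[x, u] = '[x, v]) -> u = v.
Proof.
move=> uv; apply/eqP; rewrite -subr_eq0 -rnorm_eq0 -sqrf_eq0 rnorm_sqr.
by rewrite innerBr uv subrr.
Qed.

End inner_product.

Section riesz.
Context {R : realType} {H : hilbertType R}.

Lemma quadratic_ge0_linear (a r : R) : 0 <= a ->
  (forall t : R, 0 <= t ^+ 2 * a + (t * r) *+ 2) -> r = 0.
Proof.
move=> a0 h; apply/eqP; rewrite -sqrf_eq0; apply/eqP/le_anti.
rewrite sqr_ge0 andbT.
have a1 : a + 1 != 0 by rewrite gt_eqF// ltr_wpDl.
(* The vertex of the parabola, with a + 1 in place of a in case a = 0. *)
have := h (- r / (a + 1)).
have -> : (- r / (a + 1)) ^+ 2 * a + (- r / (a + 1) * r) *+ 2 =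
   - (r ^+ 2 * (a + 2) / (a + 1) ^+ 2) by field.
rewrite oppr_ge0 pmulr_lle0 ?invr_gt0 ?exprn_gt0 ?ltr_wpDl//.
by rewrite pmulr_lle0// ltr_wpDl.
Qed.

(** The representing vector minimizes |x|^2 - 2 Re g(x): minimizing sequences
    are Cauchy by the parallelogram law, and the first variation at the
    minimizer is the required identity. *)
Lemma riesz (g : H -> R[i]) (M : R) :
  (forall c x y, g (c *: x + y) = c * g x + g y) ->
  (forall x, rnorm (g x) <= M * rnorm x) ->
  exists b, forall x, g x = '[x, b].
Proof.
move=> gl gM.
have g0 : g 0 = 0.
  by have := gl 1 0 0; rewrite scale1r mul1r addr0 => /(congr1 (fun z => z - g 0)); rewrite subrr addrK.
have gZ c x : g (c *: x) = c * g x by rewrite -[c *: x]addr0 gl g0 addr0.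
have gD x y : g (x + y) = g x + g y by rewrite -[x]scale1r gl mul1r scale1r.
pose F x := rnorm x ^+ 2 - complex.Re (g x) *+ 2.
have Flb : has_inf (range F).
  split; first by exists (F 0), 0.
  exists (- M ^+ 2) => _ [x _ <-]; rewrite /F.
  have := le_trans (Re_le_rnorm (g x)) (gM x).
  by have := sqr_ge0 (rnorm x - M); rewrite sqrrB -mulrnAr; lra.
pose m := inf (range F).
have mF x : m <= F x by apply: ge_inf; [case: Flb|exists x].
have FC x y (d : R) : F x < m + d -> F y < m + d -> rnorm (x - y) ^+ 2 <= 4 * d.
  move=> xd yd; have := mF ((2^-1)%:C *: (x + y)).
  have := parallelogram x y.
  rewrite /F gZ gD rnormZ rnormR ReZ ReD ger0_norm ?invr_ge0//.
  rewrite exprMn; move: xd yd; rewrite /F; lra.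
pose G := filter_from [set e : R | 0 < e] (fun e => [set x | F x < m + e]).
have GP : ProperFilter G.
  apply: filter_from_proper; last first.
    move=> e /= e0; have [_ [x _ <-] xe] := inf_adherent e0 Flb.
    by exists x.
  apply: filter_from_filter; first by exists 1 => /=.
  move=> a b /= a0 b0; exists (Num.min a b); first by rewrite /= lt_min a0.
  move=> x /= xab; split; rewrite /=; apply: (lt_le_trans xab).
    by rewrite lerD2l ge_min lexx.
  by rewrite lerD2l ge_min lexx orbT.
have /cvg_ex[/= b Gb] : cvg G.
  apply: cauchy_cvg; apply: cauchy_exP => _ /posC_exists[e e0 ->].
  have d0 : 0 < e ^+ 2 / 5 by rewrite divr_gt0// exprn_gt0.
  have [_ [x _ <-] xe] := inf_adherent d0 Flb.
  exists x, (e ^+ 2 / 5) => //= y ye; rewrite ball_rnorm.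
  have := FC _ _ _ xe ye => xy.
  rewrite -(@ltr_pXn2r _ 2)// ?nnegrE ?rnorm_ge0 ?(ltW e0)//.
  by apply: (le_lt_trans xy); have := exprn_gt0 2 e0; lra.
(* b is close to points where F is almost minimal, and F is Lipschitz near b. *)
have Fb : F b <= m.
  apply/ler_addgt0Pr => e e0.
  (* Bounds (F b - F x) / |b - x| for x within distance 1 of b. *)
  pose C := (rnorm b + 1) *+ 2 + `|M| *+ 2 + 1.
  have C0 : 0 < C by rewrite /C ltr_wpDl// addr_ge0// mulrn_wge0// addr_ge0// rnorm_ge0.
  pose d := Num.min 1 (e / (C + 1)).
  have C10 : 0 < C + 1 by rewrite ltr_wpDl// ltW.
  have d0 : 0 < d by rewrite lt_min ltr01 divr_gt0.
  have d1 : d <= 1 by rewrite ge_min lexx.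
  have [x [xb xm]] : exists x, rnorm (b - x) < d /\ F x < m + d.
    apply: (@filter_ex _ G); apply: filterI; last by exists d.
    by apply: Gb; apply/nbhs_rnormP; exists d.
  apply: (@le_trans _ _ (m + d + d * C)); last first.
    rewrite -addrA lerD2l -[X in X + _]mulr1 -mulrDr [1 + C]addrC.
    by rewrite -ler_pdivlMr// ge_min lexx orbT.
  have : F b - F x <= d * C.
    have h1 : rnorm b <= rnorm x + d.
      by have := ler_rdist b x; lra.
    have h2 : rnorm x <= rnorm b + 1.
      by have := ler_rdist x b; rewrite rdistC; lra.
    have h3 : complex.Re (g x) - complex.Re (g b) <= `|M| * d.
      rewrite -ReB -mulN1r -gZ -gD scaleN1r (le_trans (Re_le_rnorm _))//.
      rewrite (le_trans (gM _))// rdistC.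
      rewrite (le_trans (ler_wpM2r (rnorm_ge0 _) (ler_norm M)))//.
      by rewrite ler_wpM2l// ltW.
    have h4 : rnorm b ^+ 2 <= (rnorm x + d) ^+ 2.
      by rewrite ler_pXn2r// ?nnegrE ?addr_ge0 ?rnorm_ge0// ltW.
    have h5 : rnorm x * d <= (rnorm b + 1) * d by rewrite ler_wpM2r// ltW.
    have h6 : d * d <= d by rewrite ler_piMr// ltW.
    by rewrite /F /C; move: h4; rewrite sqrrD !mulr2n; lra.
  lra.
exists b => z.
have key (x : H) : complex.Re ('[x, b] - g x) = 0.
  apply: (@quadratic_ge0_linear (rnorm x ^+ 2)); first exact: sqr_ge0.
  move=> t; have := le_trans Fb (mF (t%:C *: x + b)).
  rewrite /F rnormD_sqr rnormZ gD gZ innerZl ReD !ReZ rnormR exprMn real_normK ?num_real//.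
  rewrite ReB; lra.
apply/eqP; rewrite eq_sym -subr_eq0 eq_complex key eqxx /=.
have := key ('i%C *: z); rewrite gZ innerZl -mulrBr mulrC ReiNIm => /eqP.
by rewrite oppr_eq0.
Qed.

End riesz.

Section adjoint.
Context {R : realType}.
Implicit Types H K : hilbertType R.

Lemma adjointP H K (A : 'B(H, K)) u v : '[A u, v] = '[u, adjoint A v].
Proof.
suff [B AB] : exists B : 'B(K, H), forall u v, '[A u, v] = '[u, B v].
  have /= := @xgetPex _ 0 [set C : 'B(K, H) | forall u v, '[A u, v] = '[u, C v]].
  by move=> /(_ (ex_intro _ B AB)); exact.
have [B AB] : exists B : K -> H, forall v u, '[A u, v] = '[u, B v].
  suff : forall w, exists b, forall u, '[A u, w] = '[u, b].
    by move=> /choice[B AB]; exists B.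
  move=> w; apply: (@riesz _ _ (fun u => '[A u, w]) (rnorm A * rnorm w)).
    by move=> c x y; rewrite bop_linear innerDl innerZl.
  move=> x; rewrite (le_trans (cauchy_schwarz _ _))// mulrAC.
  by rewrite ler_wpM2r ?rnorm_ge0 ?bop_le.
have Bl : linear B.
  move=> c x y; apply: innerI => w.
  by rewrite -AB innerDr innerZr innerDr innerZr -!AB.
have Bb : exists M, forall x, rnorm (B x) <= M * rnorm x.
  exists (rnorm A) => x; have [->|Bx] := eqVneq (B x) 0.
    by rewrite rnorm0 mulr_ge0 ?rnorm_ge0.
  have Bx0 := rnorm_gt0 Bx; rewrite -(ler_pM2l Bx0) -expr2 rnorm_sqr -AB.
  rewrite (le_trans (Re_le_rnorm _))// (le_trans (cauchy_schwarz _ _))//.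
  by rewrite mulrA ler_wpM2r ?rnorm_ge0// [leRHS]mulrC bop_le.
by exists (make_bop Bl Bb) => x y; rewrite AB.
Qed.

Lemma adjointPr H K (A : 'B(H, K)) u v : '[u, A v] = '[adjoint A u, v].
Proof. by rewrite innerC adjointP -innerC. Qed.

Lemma adjointK H K (A : 'B(H, K)) : adjoint (adjoint A) = A.
Proof. by apply: bopP => x; apply: innerI => y; rewrite -adjointP adjointPr. Qed.

Lemma adjointB H K (A B : 'B(H, K)) : adjoint (A - B) = adjoint A - adjoint B.
Proof.
apply: bopP => x; apply: innerI => y.
by rewrite -adjointP !bop_subE innerBl innerBr -!adjointP.
Qed.

Lemma rnorm_adjoint_le H K (A : 'B(H, K)) : rnorm (adjoint A) <= rnorm A.
Proof.
apply: rnorm_bop_le_scale (rnorm_ge0 _) _ => x.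
have [->|Bx] := eqVneq (adjoint A x) 0.
  by rewrite rnorm0 mulr_ge0 ?rnorm_ge0.
have Bx0 := rnorm_gt0 Bx; rewrite -(ler_pM2l Bx0) -expr2 rnorm_sqr -adjointP.
rewrite (le_trans (Re_le_rnorm _))// (le_trans (cauchy_schwarz _ _))//.
by rewrite mulrA ler_wpM2r ?rnorm_ge0// [leRHS]mulrC bop_le.
Qed.

Lemma rnorm_adjoint H K (A : 'B(H, K)) : rnorm (adjoint A) = rnorm A.
Proof.
apply/eqP; rewrite eq_le rnorm_adjoint_le/=.
by rewrite -{1}(adjointK A) rnorm_adjoint_le.
Qed.

End adjoint.

(** * Orthogonal projections of finite rank *)

Section projections.
Context {R : realType} {H : hilbertType R}.
Implicit Types (u v x y : H) (es : seq H).

Lemma rank_one_proof u v : (fun x => '[x, v] *: u) \in @bounded_linear R H H.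
Proof.
apply/asboolP; split.
  by move=> c x y; rewrite innerDl innerZl scalerDl scalerA.
exists (rnorm v * rnorm u) => x; rewrite rnormZ mulrAC.
by rewrite ler_wpM2r ?rnorm_ge0// mulrC cauchy_schwarz.
Qed.
Definition rank_one u v : 'B(H) := BOp (rank_one_proof u v).

(** Orthogonal projection onto the span, as soon as es is orthonormal. *)
Definition projection es : 'B(H) := \sum_(e <- es) rank_one e e.

Lemma projectionE es x : projection es x = \sum_(e <- es) '[x, e] *: e.
Proof. exact: sum_bopE. Qed.

Lemma projection_adj es x y : '[projection es x, y] = '[x, projection es y].
Proof.
rewrite [RHS]innerC !projectionE !inner_suml rmorph_sum/=.
apply: eq_bigr => e _.
by rewrite !innerZl rmorphM/= -(innerC e y) -(innerC x e) mulrC.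
Qed.

Lemma orthonormal_cons e es : orthonormal inner (e :: es) <->
  [/\ '[e, e] = 1, {in es, forall f, '[e, f] = 0} & orthonormal inner es].
Proof.
rewrite /orthonormal /= andbT; split.
  by move=> /and3P[/andP[/eqP ee n] /allP ef o]; split => //; [move=> f /ef/eqP|apply/andP].
move=> [/eqP ee ef /andP[n o]]; apply/and3P; split; [exact/andP| |by []].
by apply/allP => f /ef /= ef0; apply/eqP.
Qed.

Lemma orthonormal_rnorm es e : orthonormal inner es -> e \in es -> rnorm e = 1.
Proof.
move=> /andP[/allP n _] /n/eqP ee; apply/eqP.
by rewrite -(@eqrXn2 _ 2)// ?rnorm_ge0// rnorm_sqr ee expr1n.
Qed.

Lemma projection_perp es x v : {in es, forall e, '[v, e] = 0} ->
  '[projection es x, v] = 0.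
Proof.
move=> ve; rewrite projectionE inner_suml big_seq big1// => e ees.
by rewrite innerZl (innerC e v) ve// rmorph0 mulr0.
Qed.

Lemma sub_projection_perp es x : orthonormal inner es ->
  {in es, forall e, '[x - projection es x, e] = 0}.
Proof.
elim: es => // e es IH /orthonormal_cons[ee ef o] f.
have -> : projection (e :: es) x = '[x, e] *: e + projection es x.
  by rewrite !projectionE big_cons.
rewrite inE => /orP[/eqP ->|fes].
  by rewrite innerBl innerDl innerZl ee mulr1 projection_perp// addr0 subrr.
by rewrite [X in x - X]addrC opprD addrA innerBl IH// innerZl ef// mulr0 subr0.
Qed.

Lemma sub_projection_sqr es x : orthonormal inner es ->
  complex.Re '[x, x - projection es x] = rnorm (x - projection es x) ^+ 2.
Proof.
move=> o; rewrite rnorm_sqr -{1}(subrK (projection es x) x) [in LHS]innerDl.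
by rewrite projection_perp ?addr0//; exact: sub_projection_perp.
Qed.

Lemma rnorm_projection_sqr es x : orthonormal inner es ->
  rnorm (projection es x) ^+ 2 + rnorm (x - projection es x) ^+ 2 = rnorm x ^+ 2.
Proof.
move=> o; have xE : x = projection es x + (x - projection es x) by rewrite addrC subrK.
rewrite [in RHS]xE [in RHS]rnormD_sqr.
by rewrite projection_perp ?mul0rn ?addr0//; exact: sub_projection_perp.
Qed.

Lemma rnorm_projection_le es x : orthonormal inner es ->
  rnorm (projection es x) <= rnorm x.
Proof.
move=> o; rewrite -(@ler_pXn2r _ 2)// ?nnegrE ?rnorm_ge0//.
by rewrite -(rnorm_projection_sqr x o) lerDl sqr_ge0.
Qed.

Lemma rnorm_sub_projection_le es x : orthonormal inner es ->
  rnorm (x - projection es x) <= rnorm x.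
Proof.
move=> o; rewrite -(@ler_pXn2r _ 2)// ?nnegrE ?rnorm_ge0//.
by rewrite -(rnorm_projection_sqr x o) lerDr sqr_ge0.
Qed.

(** The hypothesis on y holds when y lies in the span of es: the projection is
    the nearest point of that span. *)
Lemma sub_projection_min es x y : orthonormal inner es ->
  '[y, x - projection es x] = 0 -> rnorm (x - projection es x) <= rnorm (x - y).
Proof.
set v := x - projection es x => o yv; have [->|v0] := eqVneq v 0.
  by rewrite rnorm0 rnorm_ge0.
rewrite -(ler_pM2r (rnorm_gt0 v0)) -expr2 -sub_projection_sqr// -/v.
rewrite (_ : '[x, v] = '[x - y, v]); last by rewrite innerBl yv subr0.
by rewrite (le_trans (Re_le_rnorm _))// cauchy_schwarz.
Qed.

Lemma gram_schmidt (ys : seq H) : exists2 es, orthonormal inner es &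
  forall v, {in es, forall e, '[v, e] = 0} -> {in ys, forall y, '[v, y] = 0}.
Proof.
elim: ys => [|y ys [es o esP]]; first by exists [::].
pose r := y - projection es y.
have yE v : {in es, forall e, '[v, e] = 0} -> '[v, y] = '[v, r].
  move=> ve; rewrite -{1}(subrK (projection es y) y) innerDr.
  by rewrite [X in _ + X]innerC projection_perp// rmorph0 addr0.
have [r0|r0] := eqVneq r 0.
  exists es => // v ve z; rewrite inE => /orP[/eqP ->|]; last exact: esP.
  by rewrite yE// r0 inner0r.
have nr := rnorm_gt0 r0; pose e := (rnorm r)^-1%:C *: r.
have rE : r = (rnorm r)%:C *: e.
  by rewrite /e scalerA -rmorphM/= mulfV ?gt_eqF// scale1r.
exists (e :: es).
  apply/orthonormal_cons; split => //.
    rewrite /e innerZl innerZr inner_rnorm conjc_real -!rmorphM/=.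
    by rewrite expr2 mulKf ?gt_eqF// mulVf// gt_eqF.
  by move=> f fes; rewrite /e innerZl sub_projection_perp// mulr0.
move=> v ve; have vr : '[v, r] = 0 by rewrite rE innerZr ve ?mem_head// mulr0.
have ves : {in es, forall e, '[v, e] = 0}.
  by move=> f fes; rewrite ve// inE fes orbT.
move=> z; rewrite inE => /orP[/eqP ->|zys]; first by rewrite yE.
exact: esP.
Qed.

(** A bounded set is totally bounded exactly when finite-dimensional subspaces
    approximate it uniformly. Unlike a net, the subspace can be tested by duality,
    on the residuals x - projection es x. *)
Definition nearly_finite_dim (X : set H) := forall e : R, 0 < e ->
  exists2 es, orthonormal inner es &
    forall x, X x -> rnorm (x - projection es x) <= e.

Lemma totally_bounded_nearly_finite_dim (X : set H) :
  totally_bounded X -> nearly_finite_dim X.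
Proof.
move=> Xtb e /Xtb[l Xl]; have [es o esP] := gram_schmidt l.
exists es => // x /Xl[a al xa]; rewrite (le_trans _ (ltW xa))//.
apply: sub_projection_min => //.
by rewrite innerC esP ?rmorph0//; exact: sub_projection_perp.
Qed.

Lemma nearly_finite_dim_totally_bounded (X : set H) (M : R) :
  (forall x, X x -> rnorm x <= M) ->
  nearly_finite_dim X -> totally_bounded X.
Proof.
move=> XM Xf; apply: totally_bounded_close => e /Xf[es o Xes].
have M0 : 0 <= `|M| by [].
eexists; first exact: (totally_bounded_combination es id M0).
move=> x Xx; exists (projection es x); last exact: Xes.
exists (fun e => if e \in es then '[x, e] else 0).
  move=> f; case: ifPn => [fes|_]; last by rewrite rnorm0.
  rewrite (le_trans (cauchy_schwarz _ _))// (orthonormal_rnorm o fes) mulr1.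
  by rewrite (le_trans (XM _ Xx))// ler_norm.
by rewrite projectionE big_seq [RHS]big_seq; apply: eq_bigr => f ->.
Qed.

End projections.

(** * Relatively compact families of compact operators *)

Section families_of_operators.
Context {R : realType} {H : hilbertType R}.
Implicit Types (S T : 'B(H)) (K : set 'B(H)).

Definition unit_images K : set H :=
  [set x | exists S u, [/\ K S, rnorm u <= 1 & x = S u]].

Lemma totally_bounded_image (V W : normedModType R[i]) (A : 'B(V, W)) (X : set V) :
  totally_bounded X -> totally_bounded (A @` X).
Proof.
move=> Xtb e e0; have A1 : 0 < rnorm A + 1 by rewrite ltr_wpDl// rnorm_ge0.
have [|l Xl] := Xtb (e / (rnorm A + 1)); first by rewrite divr_gt0.
exists (map A l) => _ [x /Xl[a al xa] <-]; exists (A a); first exact: map_f.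
rewrite -bopB (le_lt_trans (bop_le _ _))//.
rewrite (le_lt_trans (y := (rnorm A + 1) * rnorm (x - a)))//.
  by rewrite ler_wpM2r ?rnorm_ge0// lerDl.
by rewrite mulrC -ltr_pdivlMr.
Qed.

Lemma totally_bounded_finite_union (V : normedModType R[i]) (I : eqType)
    (l : seq I) (B : I -> set V) : {in l, forall i, totally_bounded (B i)} ->
  totally_bounded [set x | exists2 i, i \in l & B i x].
Proof.
move=> lB e e0; elim: l lB => [|i l IH] lB.
  by exists [::] => x [].
have [k Bk] := lB i (mem_head _ _) _ e0.
have [|m Bm] := IH; first by move=> j jl; apply: lB; rewrite inE jl orbT.
exists (k ++ m) => x [j]; rewrite inE => /orP[/eqP -> /Bk[a ak xa]|jl Bj].
  by exists a; rewrite // mem_cat ak.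
by have [|a am xa] := Bm x; [exists j|exists a; rewrite // mem_cat am orbT].
Qed.

(** Schauder's theorem in quantitative form:
    |S^* u - S^* v|^2 = <S (S^* u - S^* v), u - v> is controlled by the
    distance of S S^* u and S S^* v, and S S^* maps the ball into a multiple
    of the image of the ball under S. *)
Lemma totally_bounded_adjoint S :
  totally_bounded (S @` closed_unit_ball H) ->
  totally_bounded (adjoint S @` closed_unit_ball H).
Proof.
move=> Stb; pose M := rnorm (adjoint S) + 1.
have M0 : 0 < M by rewrite ltr_wpDl// rnorm_ge0.
have SStb : totally_bounded ((S \oB adjoint S) @` closed_unit_ball H).
  have := totally_bounded_image (M%:C *: bop_id H) Stb.
  apply: sub_totally_bounded => _ [u u1 <-] /=.
  exists (S ((M^-1)%:C *: adjoint S u)); last first.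
    change (M%:C *: S ((M^-1)%:C *: adjoint S u) = S (adjoint S u)).
    by rewrite -bopZ scalerA -rmorphM/= mulfV ?gt_eqF// scale1r.
  exists ((M^-1)%:C *: adjoint S u) => //; rewrite /closed_unit_ball/=.
  rewrite rnormZ rnormR ger0_norm ?invr_ge0 ?(ltW M0)//.
  rewrite ler_pdivrMl// mulr1 (le_trans (bop_le_ball _ u1))// /M.
  by rewrite lerDl.
move=> e e0; have d0 : 0 < e ^+ 2 / 2 by rewrite divr_gt0// exprn_gt0.
have [l lP Xl] := totally_bounded_inner SStb d0.
have /choice[b bP] : forall a : H, exists u : H, a \in l ->
    rnorm u <= 1 /\ S (adjoint S u) = a.
  move=> a; have [/lP[u u1 <-]|_] := boolP (a \in l); first by exists u.
  by exists 0.
exists [seq adjoint S (b a) | a <- l] => _ [u u1 <-].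
have [|a al ua] := Xl (S (adjoint S u)); first by exists u.
exists (adjoint S (b a)); first exact: (map_f (fun a => adjoint S (b a))).
have [b1 Sb] := bP a al.
rewrite -(@ltr_pXn2r _ 2)// ?nnegrE ?rnorm_ge0 ?(ltW e0)//.
rewrite rnorm_sqr -bopB -adjointP (le_lt_trans (Re_le_rnorm _))//.
rewrite (le_lt_trans (cauchy_schwarz _ _))// !bopB Sb.
rewrite (le_lt_trans (y := rnorm (S (adjoint S u) - a) * 2))//.
  rewrite ler_wpM2l ?rnorm_ge0// (le_trans (rnormD _ _))// rnormN.
  have -> : (2 : R) = 1 + 1 by [].
  exact: lerD.
by rewrite -ltr_pdivlMr.
Qed.

(** Finitely many operators T approximate K in norm, and their adjoints
    approximate the adjoints equally well; for each T the images of the ball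
    under T and its adjoint are totally bounded. *)
Lemma precompact_totally_bounded_images K :
  precompact K -> (forall S, K S -> compact_operator S) ->
  totally_bounded (unit_images (with_adjoints K)).
Proof.
move=> /precompact_totally_bounded/totally_bounded_inner Kl Kc.
apply: totally_bounded_close => e e0; have [l lK {}Kl] := Kl _ e0.
pose B T := T @` closed_unit_ball H `|` adjoint T @` closed_unit_ball H.
exists [set x | exists2 T, T \in l & B T x].
  apply: totally_bounded_finite_union => T /lK/Kc/precompact_totally_bounded Ttb.
  have Ttb' := totally_bounded_adjoint Ttb.
  move=> d d0; have [l1 Tl1] := Ttb _ d0; have [l2 Tl2] := Ttb' _ d0.
  exists (l1 ++ l2) => x [/Tl1|/Tl2] [a al xa];
    by exists a; rewrite // mem_cat al ?orbT.
move=> _ [S [u [+ u1 ->]]] => -[KS|[T KT <-]].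
  have [T Tl ST] := Kl _ KS; exists (T u).
    by exists T => //; left; exists u.
  by rewrite -bop_subE (le_trans (bop_le_ball _ u1))// ltW.
have [T' T'l TT'] := Kl _ KT; exists (adjoint T' u).
  by exists T' => //; right; exists u.
rewrite -bop_subE -adjointB (le_trans (bop_le_ball _ u1))//.
by rewrite rnorm_adjoint ltW.
Qed.

Lemma totally_bounded_images_compact K S :
  totally_bounded (unit_images K) -> K S -> compact_operator S.
Proof.
move=> Ktb KS; apply: totally_bounded_precompact.
by apply: sub_totally_bounded Ktb => _ [u u1 <-]; exists S, u.
Qed.

(** With P a projection of finite rank that nearly fixes the images of S and
    of S^*, the operator S is close to P S P, which ranges over a bounded
    part of a finite-dimensional space of operators. *)
Lemma totally_bounded_images_precompact K :
  totally_bounded (unit_images (with_adjoints K)) -> precompact K.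
Proof.
move=> Ktb; have [M M0 KM] := totally_bounded_bounded Ktb.
have Kf := totally_bounded_nearly_finite_dim Ktb.
apply: totally_bounded_precompact; apply: totally_bounded_close => e e0.
have e20 : 0 < e / 2 by rewrite divr_gt0.
have [es o esP] := Kf _ e20; set P := projection es in esP.
pose s := [seq (a, b) | a <- es, b <- es].
eexists.
  exact: (totally_bounded_combination s (fun p => rank_one p.1 p.2) M0).
move=> S KS; exists (P \oB S \oB P).
  exists (fun p => if (p.1 \in es) && (p.2 \in es) then '[S p.2, p.1] else 0).
    move=> [a b] /=; case: ifPn => [/andP[aes bes]|_]; last by rewrite rnorm0.
    rewrite (le_trans (cauchy_schwarz _ _))// (orthonormal_rnorm o aes) mulr1.
    apply: KM; exists S, b; split => //; first by left.
    by rewrite (orthonormal_rnorm o bes).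
  apply: bopP => x; rewrite sum_bopE /s big_allpairs.
  transitivity (P (S (P x))); last by [].
  rewrite /P [RHS]projectionE big_seq [RHS]big_seq.
  apply: eq_bigr => a aes; rewrite (projectionE es x) bop_sum inner_suml scaler_suml.
  rewrite big_seq [RHS]big_seq; apply: eq_bigr => b bes /=.
  rewrite aes bes/= bopZ innerZl mulrC.
  change ('[S b, a] *: ('[x, b] *: a) = ('[S b, a] * '[x, b]) *: a).
  by rewrite scalerA.
have PS T : with_adjoints K T -> rnorm (T - P \oB T) <= e / 2.
  move=> KT; apply: rnorm_bop_le => x x1; apply: esP; by exists T, x.
have SP : rnorm (S - S \oB P) <= e / 2.
  rewrite -rnorm_adjoint (_ : adjoint _ = adjoint S - P \oB adjoint S).
    by apply: PS; right; exists S.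
  apply: bopP => x; apply: innerI => y; rewrite -adjointP.
  change ('[S y - S (P y), x] = '[y, adjoint S x - P (adjoint S x)]).
  by rewrite innerBl innerBr !(adjointP S) /P projection_adj.
rewrite (le_trans (rdist_triangle (P \oB S) _ _))// (splitr e) lerD//.
  by apply: PS; left.
apply: rnorm_bop_le => x x1.
change (rnorm (P (S x) - P (S (P x))) <= e / 2).
rewrite -bopB (le_trans (rnorm_projection_le _ o))//.
exact: le_trans (bop_le_ball (S - S \oB P) x1) SP.
Qed.

End families_of_operators.

(** * Square integrable functions *)

Section square_modulus.
Context {R : realType} {T : Type}.

Definition sq (g : T -> R[i]) : T -> R := fun s => rnorm (g s) ^+ 2.

Lemma sq_ge0 g s : 0 <= sq g s. Proof. exact: sqr_ge0. Qed.

End square_modulus.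

Section nonnegative_integrals.
Context {R : realType} d (T : measurableType d).
Variable mu : {measure set T -> \bar R}.
Implicit Types (A B : set T) (f : T -> R) (g h : T -> R[i]).

Lemma ge0_integrable f : measurable_fun setT f -> (forall x, 0 <= f x) ->
  (\int[mu]_x (f x)%:E < +oo)%E -> mu.-integrable setT (EFin \o f).
Proof.
move=> mf f0 foo; apply/integrableP; split; first exact/measurable_EFinP.
by under eq_integral do rewrite /= ger0_norm//.
Qed.

Lemma integrable_sub f A : mu.-integrable setT (EFin \o f) -> measurable A ->
  mu.-integrable A (EFin \o f).
Proof. by move=> fi mA; apply: integrableS fi. Qed.

Lemma RintegralE f A : mu.-integrable A (EFin \o f) -> measurable A ->
  (\int[mu]_(x in A) f x)%:E = (\int[mu]_(x in A) (f x)%:E)%E.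
Proof. by move=> fi mA; rewrite /Rintegral fineK//; exact: integrable_fin_num. Qed.

Lemma Rintegral_split f A : mu.-integrable setT (EFin \o f) -> measurable A ->
  \int[mu]_x f x = \int[mu]_(x in A) f x + \int[mu]_(x in ~` A) f x.
Proof.
move=> fi mA; rewrite -Rintegral_setU ?setUv//; first exact: measurableC.
by rewrite disj_set2E setICr.
Qed.

Lemma Rintegral_sub_le f A B : mu.-integrable setT (EFin \o f) ->
  (forall x, 0 <= f x) -> measurable A -> measurable B -> A `<=` B ->
  \int[mu]_(x in A) f x <= \int[mu]_(x in B) f x.
Proof.
move=> fi f0 mA mB AB; rewrite -lee_fin !RintegralE//; try exact: integrable_sub.
apply: ge0_subset_integral => //; last by move=> x _; rewrite lee_fin.
by have /integrableP[] := integrable_sub fi mB.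
Qed.

Lemma L2norm_sqr (g : T -> R[i]) :
  (L2norm mu g `^ 2 = \int[mu]_s (sq g s)%:E)%E.
Proof.
rewrite /L2norm poweR_Lnorm//; apply: eq_integral => s _ /=.
by rewrite ger0_norm ?rnorm_ge0// (powR_mulrn 2)// rnorm_ge0.
Qed.

Lemma L2norm_le (g : T -> R[i]) (e : R) : 0 <= e ->
  (L2norm mu g <= e%:E)%E <-> (\int[mu]_s (sq g s)%:E <= (e ^+ 2)%:E)%E.
Proof.
move=> e0; have pos (x : \bar R) : (0 <= x -> x \in `[0, +oo%E])%E.
  by move=> x0; rewrite in_itv /= x0 leey.
have e2 : (e%:E `^ 2 = (e ^+ 2)%:E)%E by rewrite poweR_EFin (powR_mulrn 2).
rewrite -L2norm_sqr -e2; split => h.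
  by apply: gt0_ler_poweR => //; apply: pos; rewrite ?Lnorm_ge0// lee_fin.
have := @gt0_ler_poweR R 2^-1.
move=> /(_ _ _ _ _ _ h); rewrite -!poweRrM divff// !poweRe1 ?Lnorm_ge0 ?lee_fin//.
by apply; rewrite ?invr_ge0//; apply: pos; exact: poweR_ge0.
Qed.

Lemma L2_integrable g : L2 mu g -> mu.-integrable setT (EFin \o sq g).
Proof.
move=> [mR mI goo]; apply: ge0_integrable; [|exact: sq_ge0|].
  rewrite (_ : sq g = (fun s => complex.Re (g s) ^+ 2 + complex.Im (g s) ^+ 2)).
    by apply: measurable_funD; exact: measurable_funX.
  by apply/funext => s; rewrite /sq rnorm_complex_sqr.
rewrite -L2norm_sqr; move: goo (Lnorm_ge0 mu 2%:E (EFin \o (fun s => rnorm (g s)))).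
rewrite -/(L2norm mu g); case: (L2norm mu g) => [r|//|//] _ _.
by rewrite poweR_EFin ltry.
Qed.

Lemma L2P g : measurable_fun setT (fun s => complex.Re (g s)) ->
  measurable_fun setT (fun s => complex.Im (g s)) ->
  (\int[mu]_s (sq g s)%:E < +oo)%E -> L2 mu g.
Proof.
move=> mR mI; rewrite -L2norm_sqr => goo; split => //; rewrite ltNge leye_eq.
by apply/eqP => ginf; move: goo; rewrite ginf poweRE pnatr_eq0.
Qed.

Lemma ae_eq_Rintegral_sq g h :
  measurable_fun setT (sq g) -> measurable_fun setT (sq h) ->
  {ae mu, forall s, g s = h s} -> \int[mu]_s sq g s = \int[mu]_s sq h s.
Proof.
move=> mg mh gh; rewrite /Rintegral; congr fine; apply: ge0_ae_eq_integral => //.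
- exact/measurable_EFinP.
- exact/measurable_EFinP.
- by move=> x _; rewrite lee_fin sq_ge0.
- by move=> x _; rewrite lee_fin sq_ge0.
by apply: filterS gh => x; rewrite /sq => ->.
Qed.

Lemma ae_eq_integrable_sq (g h : T -> R[i]) :
  mu.-integrable setT (EFin \o sq g) -> measurable_fun setT (sq h) ->
  {ae mu, forall s, g s = h s} -> mu.-integrable setT (EFin \o sq h).
Proof.
move=> gi mh gh; have /integrableP[mg] := gi.
under eq_integral do rewrite /= ger0_norm ?sq_ge0//.
rewrite (ge0_ae_eq_integral (g := EFin \o sq h))//.
- by apply: ge0_integrable => // s; exact: sq_ge0.
- exact/measurable_EFinP.
- by move=> x _; rewrite lee_fin sq_ge0.
- by move=> x _; rewrite lee_fin sq_ge0.
by apply: filterS gh => x; rewrite /sq /= => ->.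
Qed.

End nonnegative_integrals.

Section borel.
Context {R : realType} {S : ptopologicalType}.
Variable mu : {measure set (borel S) -> \bar R}.

Lemma open_borel (U : set S) : open U -> measurable (U : set (borel S)).
Proof. by move=> oU; exact: sub_sigma_algebra. Qed.

Lemma closed_borel (C : set S) : closed C -> measurable (C : set (borel S)).
Proof.
move=> cC; rewrite -(setCK C); apply: measurableC; apply: open_borel.
exact: closed_openC.
Qed.

Lemma compact_borel (L : set S) : hausdorff_space S -> compact L ->
  measurable (L : set (borel S)).
Proof. by move=> hS cL; apply: closed_borel; exact: compact_closed. Qed.

Lemma continuous_borel (f : S -> R) : continuous f ->
  measurable_fun setT (f : borel S -> R).
Proof.
move=> /continuousP cf; apply: (measurability _ (RGenOpens.measurableE R)).
move=> _ [_ [a [b ->] <-]]; rewrite setTI; apply: open_borel.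
exact/cf/interval_open.
Qed.

(** The integrals over an increasing exhaustion by compact sets converge to the
    full integral. *)
Lemma integrable_compact_tail (f : borel S -> R) :
  hausdorff_space S -> sigma_compact S ->
  mu.-integrable setT (EFin \o f) -> (forall s, 0 <= f s) ->
  forall e : R, 0 < e -> exists2 L : set S, compact L &
    \int[mu]_(s in ~` (L : set (borel S))) f s <= e.
Proof.
move=> hS [F cF FT] fi f0 e e0.
pose G n : set (borel S) := \big[setU/set0]_(i < n) F i.
have cG n : compact (G n : set S) by apply: bigsetU_compact => i _.
have mG n : measurable (G n) by exact: compact_borel.
have GT : \bigcup_n G n = setT.
  rewrite -subTset => s _; have [n _ Fn] : (\bigcup_n F n) s by rewrite FT.
  by exists n.+1 => //; rewrite /G big_ord_recr /=; right.
have ndG : nondecreasing_seq G.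
  move=> m n mn; apply/subsetPset; rewrite /G => s.
  by rewrite -!bigcup_mkord => -[i /= im Fi]; exists i => //=; exact: leq_trans mn.
have mf n : measurable_fun (G n) (EFin \o f).
  by have /integrableP[] := integrable_sub fi (mG n).
have f0' n x : G n x -> (0 <= (EFin \o f) x)%E by rewrite /= lee_fin.
have := @ge0_nondecreasing_set_cvg_integral _ _ _ G (EFin \o f) mu ndG mG mf f0'.
rewrite GT.
rewrite (_ : (fun i => _) = (fun i => (\int[mu]_(x in G i) f x)%:E)); last first.
  by apply/funext => n; rewrite RintegralE//; exact: integrable_sub.
rewrite -RintegralE// => /fine_cvgP[_] /=.
move=> /cvgrPdist_lt/(_ _ e0)/filter_ex[n /= nP].
exists (G n); first exact: cG.
move: nP; rewrite (Rintegral_split fi (mG n)) addrAC subrr add0r.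
by move=> /(le_lt_trans (ler_norm _))/ltW.
Qed.

End borel.

Section continuity.
Context {R : realType} {S : topologicalType}.

Lemma continuous_rnormP (V : normedModType R[i]) (g : S -> V) :
  continuous g <-> forall s (e : R), 0 < e ->
    \forall t \near s, rnorm (g s - g t) < e.
Proof.
split=> cg s; first by move=> e e0; have /cvg_rnormP := cg s; exact.
by apply/cvg_rnormP => e; exact: cg.
Qed.

Lemma continuous_lipschitz (V : normedModType R[i]) (G : V -> R) (g : S -> V) :
  (forall a b, `|G a - G b| <= rnorm (a - b)) -> continuous g ->
  continuous (G \o g).
Proof.
move=> GL /continuous_rnormP cg s; apply/cvgrPdist_lt => e e0.
by apply: filterS (cg s _ e0) => t; apply: le_lt_trans; exact: GL.
Qed.

Lemma lipschitz_rnorm (V : normedZmodType R[i]) (a b : V) :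
  `|rnorm a - rnorm b| <= rnorm (a - b).
Proof. by rewrite ler_norml ler_rdist andbT lerNl opprB rdistC ler_rdist. Qed.

Lemma lipschitz_Re (a b : R[i]) :
  `|complex.Re a - complex.Re b| <= rnorm (a - b).
Proof. by rewrite -ReB ler_Re_rnorm. Qed.

Lemma lipschitz_Im (a b : R[i]) :
  `|complex.Im a - complex.Im b| <= rnorm (a - b).
Proof.
have -> : complex.Im a - complex.Im b = complex.Im (a - b) by case: a; case: b.
have i1 : rnorm ('i%C : R[i]) = 1.
  by apply: complexI; rewrite rnormE; exact: normCi.
by have := ler_Re_rnorm ((a - b) * 'i%C); rewrite ReiNIm normrN rnormM i1 mulr1.
Qed.

End continuity.

(** * Coefficient functions and tightness *)

Section square_integrable_family.
Context {R : realType} {H : hilbertType R} {Sigma : ptopologicalType}.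
Variables (mu : {measure set (borel Sigma) -> \bar R}) (pi : Sigma -> 'B(H)).
Hypothesis Sigma_hausdorff : hausdorff_space Sigma.
Hypothesis Sigma_sc : sigma_compact Sigma.
Hypothesis mu_compact : forall L : set Sigma, compact L -> (mu L < +oo)%E.
Hypothesis pi_square_integrable : forall u v : H,
  (\int[mu]_s (rnorm '[pi s u, v] ^+ 2)%:E
    = (rnorm u ^+ 2 * rnorm v ^+ 2)%:E)%E.
Hypothesis pi_continuous : forall u : H,
  continuous (fun s : Sigma => adjoint (pi s) u).
Implicit Types (u v w x : H) (X : set H).

Lemma phiE w u s : phi pi w u s = '[u, adjoint (pi s) w].
Proof. exact: adjointP. Qed.

Lemma phiB w u v s : phi pi w (u - v) s = phi pi w u s - phi pi w v s.
Proof. by rewrite !phiE innerBl. Qed.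

Lemma phi_continuous w u : continuous (phi pi w u : Sigma -> R[i]^o).
Proof.
apply/continuous_rnormP => s e e0.
have u1 : 0 < rnorm u + 1 by rewrite ltr_wpDl// rnorm_ge0.
have /continuous_rnormP := @pi_continuous w.
move=> /(_ s (e / (rnorm u + 1)))/[!divr_gt0]// /(_ isT).
apply: filterS => t st; rewrite !phiE.
change (rnorm ('[u, adjoint (pi s) w] - '[u, adjoint (pi t) w] : R[i]) < e).
rewrite -innerBr (le_lt_trans (cauchy_schwarz _ _))//.
rewrite (le_lt_trans (y := (rnorm u + 1) * rnorm (adjoint (pi s) w - adjoint (pi t) w)))//.
  by rewrite ler_wpM2r ?rnorm_ge0// lerDl.
by rewrite mulrC -ltr_pdivlMr.
Qed.

Lemma sq_continuous (g : Sigma -> R[i]) : continuous (g : Sigma -> R[i]^o) ->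
  continuous (sq g : Sigma -> R).
Proof.
move=> cg s; change ({for s, continuous ((fun x : R => x ^+ 2) \o (fun s => rnorm (g s)))}).
apply: continuous_comp.
  exact: (continuous_lipschitz (@lipschitz_rnorm _ R[i]^o) cg).
exact: exprn_continuous.
Qed.

Lemma phi_integrable w u : mu.-integrable setT (EFin \o sq (phi pi w u)).
Proof.
apply: ge0_integrable; [|exact: sq_ge0|].
  exact: (continuous_borel (sq_continuous (@phi_continuous w u))).
by rewrite pi_square_integrable ltry.
Qed.

Lemma Rintegral_phi w u :
  \int[mu]_s sq (phi pi w u) s = rnorm u ^+ 2 * rnorm w ^+ 2.
Proof. by rewrite /Rintegral pi_square_integrable. Qed.

Definition phi_tail w (L : set Sigma) u : R :=
  \int[mu]_(s in ~` (L : set (borel Sigma))) sq (phi pi w u) s.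

Lemma compact_borelC (L : set Sigma) : compact L ->
  measurable (~` (L : set (borel Sigma))).
Proof. by move=> cL; apply: measurableC; exact: compact_borel. Qed.

Lemma phi_tail_le w (L : set Sigma) u : compact L ->
  phi_tail w L u <= rnorm u ^+ 2 * rnorm w ^+ 2.
Proof.
move=> cL; rewrite -Rintegral_phi; apply: Rintegral_sub_le => //.
- exact: phi_integrable.
- exact: sq_ge0.
- exact: compact_borelC.
Qed.

Lemma phi_tail_sub w (L L' : set Sigma) u : compact L -> compact L' -> L `<=` L' ->
  phi_tail w L' u <= phi_tail w L u.
Proof.
move=> cL cL' LL'; apply: Rintegral_sub_le.
- exact: phi_integrable.
- exact: sq_ge0.
- exact: compact_borelC.
- exact: compact_borelC.
- exact: subsetC.
Qed.

Lemma L2norm_restr_compl w (L : set Sigma) u (e : R) : 0 <= e -> compact L ->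
  (L2norm mu (restr_compl L (phi pi w u)) <= e%:E)%E <-> phi_tail w L u <= e ^+ 2.
Proof.
move=> e0 cL; rewrite L2norm_le// -lee_fin RintegralE; first last.
- exact: compact_borelC.
- by apply: integrable_sub (compact_borelC cL); exact: phi_integrable.
rewrite [in X in _ <-> X]integral_mkcond.
suff -> : (fun s => (sq (restr_compl L (phi pi w u)) s)%:E) =
  (fun s => (sq (phi pi w u) s)%:E) \_ (~` L) by [].
apply/funext => s; rewrite /sq /restr_compl patchE indicE in_setC.
by case: (s \in L) => /=; rewrite ?subrr ?subr0 ?mul0r ?mul1r// rnorm0 expr0n.
Qed.

Lemma uniformly_tightP w (K : set 'B(H)) : uniformly_tight mu pi w K <->
  forall e : R, 0 < e -> exists2 L : set Sigma, compact L &
    forall x, unit_images K x -> phi_tail w L x <= e.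
Proof.
split=> Kt e e0.
  have [|L cL LK] := Kt (Num.sqrt e); first by rewrite sqrtr_gt0.
  exists L => // _ [S [u [KS u1 ->]]].
  rewrite -(sqr_sqrtr (ltW e0)); apply/L2norm_restr_compl => //.
  apply: le_trans (le_trans (ereal_sup_ubound _) LK); last by exists S.
  by apply: ereal_sup_ubound; exists u.
have [|L cL LK] := Kt (e ^+ 2); first by rewrite exprn_gt0.
exists L => //; apply: ge_ereal_sup => _ [S KS <-].
apply: ge_ereal_sup => _ [u u1 <-].
by apply/L2norm_restr_compl => //; [exact: ltW|apply: LK; exists S, u].
Qed.

(** Each single coefficient function is square integrable, hence has small
    tails; as the tail of x - a is at most |x - a|^2 |w|^2, a finite net
    propagates this to totally bounded sets. *)
Lemma totally_bounded_tight w X : totally_bounded X ->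
  forall e : R, 0 < e -> exists2 L : set Sigma, compact L &
    forall x, X x -> phi_tail w L x <= e.
Proof.
move=> Xtb e e0.
pose W := rnorm w ^+ 2; have W0 : 0 <= W by exact: sqr_ge0.
have W1 : 0 < W + 1 by rewrite ltr_wpDl.
have e40 : 0 < e / 4 by rewrite divr_gt0.
pose d := Num.min 1 (e / 4 / (W + 1)).
have d0 : 0 < d by rewrite lt_min ltr01 divr_gt0.
have [l Xl] := Xtb _ d0.
have [L cL Ll] : exists2 L : set Sigma, compact L &
    {in l, forall a, phi_tail w L a <= e / 4}.
  elim: l {Xl} => [|a l [L cL Ll]]; first by exists set0 => //; exact: compact0.
  have [L' cL' L'a] := integrable_compact_tail Sigma_hausdorff Sigma_sc
    (phi_integrable w a) (sq_ge0 _) e40.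
  have cLL' := compactU cL cL'.
  exists (L `|` L') => // b; rewrite inE => /orP[/eqP ->|/Ll bL].
    by apply: le_trans L'a; apply: phi_tail_sub => //; exact: subsetUr.
  by apply: le_trans bL; apply: phi_tail_sub => //; exact: subsetUl.
exists L => // x /Xl[a /Ll al xa].
have key s : sq (phi pi w x) s <=
    2 * sq (phi pi w (x - a)) s + 2 * sq (phi pi w a) s.
  rewrite /sq phiB.
  set y := phi pi w x s; set z := phi pi w a s.
  have := rnormD (y - z) z; rewrite subrK => yz.
  have := sqr_ge0 (rnorm (y - z) - rnorm z).
  have : rnorm y ^+ 2 <= (rnorm (y - z) + rnorm z) ^+ 2.
    by rewrite ler_pXn2r// ?nnegrE ?addr_ge0 ?rnorm_ge0.
  by rewrite sqrrD sqrrB !mulr2n; lra.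
have int2 v : mu.-integrable (~` (L : set (borel Sigma)))
    (EFin \o (fun s => 2 * sq (phi pi w v) s)).
  have := integrable_sub (phi_integrable w v) (compact_borelC cL).
  by move=> /(integrableZl (compact_borelC cL) 2).
have tE v : \int[mu]_(s in ~` (L : set (borel Sigma))) (2 * sq (phi pi w v) s)
    = 2 * phi_tail w L v.
  by rewrite RintegralZl//; [exact: compact_borelC|exact: integrable_sub (phi_integrable _ _) (compact_borelC cL)].
apply: (@le_trans _ _ (2 * phi_tail w L (x - a) + 2 * phi_tail w L a)).
  rewrite -!tE -RintegralD//; [|exact: compact_borelC].
  apply: le_Rintegral => //; first exact: compact_borelC.
  - exact: integrable_sub (phi_integrable _ _) (compact_borelC cL).
  - exact: (integrableD (compact_borelC cL) (int2 (x - a)) (int2 a)).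
have : phi_tail w L (x - a) <= e / 4.
  rewrite (le_trans (phi_tail_le _ _ cL))// -/W.
  have : rnorm (x - a) ^+ 2 <= d.
    have d1 : d <= 1 by rewrite ge_min lexx.
    rewrite expr2 -[leRHS]mulr1.
    by rewrite ler_pM ?rnorm_ge0// ?ltW// (lt_le_trans xa).
  have dW : d <= e / 4 / (W + 1) by rewrite ge_min lexx orbT.
  move=> /le_trans/(_ dW).
  rewrite ler_pdivlMr// => h; apply: le_trans h.
  by rewrite ler_wpM2l ?sqr_ge0// lerDl.
lra.
Qed.

End square_integrable_family.

Lemma integrable_cst_fin {R : realType} d (T : measurableType d)
    (mu : {measure set T -> \bar R}) (A : set T) (r : R) :
  measurable A -> (mu A < +oo)%E -> mu.-integrable A (EFin \o (fun=> r)).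
Proof.
move=> mA muA; apply/integrableP; split; first exact/measurable_EFinP.
by rewrite (eq_integral (cst `|r|%:E))// integral_cst// lte_mul_pinfty.
Qed.

Lemma le_Rintegral_combination {R : realType} d (T : measurableType d)
    (mu : {measure set T -> \bar R}) (A : set T) (a b c : T -> R) (p q : R) :
  measurable A -> mu.-integrable A (EFin \o a) -> mu.-integrable A (EFin \o b) ->
  mu.-integrable A (EFin \o c) ->
  (forall x, A x -> a x + b x <= c x + (p * a x + q * b x)) ->
  \int[mu]_(x in A) a x + \int[mu]_(x in A) b x <= \int[mu]_(x in A) c x +
    (p * \int[mu]_(x in A) a x + q * \int[mu]_(x in A) b x).
Proof.
move=> mA ia ib ic abc.
have ipa : mu.-integrable A (EFin \o (fun x => p * a x)) by exact: (integrableZl mA p ia).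
have iqb : mu.-integrable A (EFin \o (fun x => q * b x)) by exact: (integrableZl mA q ib).
have ipq : mu.-integrable A (EFin \o (fun x => p * a x + q * b x)).
  exact: (integrableD mA ipa iqb).
rewrite -!RintegralZl// -!RintegralD//; apply: le_Rintegral => //.
  exact: (integrableD mA ia ib).
exact: (integrableD mA ic ipq).
Qed.

Lemma sqr_modulus_sub_ge {R : realType} (z w : R[i]) (t : R) : 0 < t ->
  rnorm z ^+ 2 + rnorm w ^+ 2 <=
  rnorm (z - w) ^+ 2 + (t * rnorm z ^+ 2 + t^-1 * rnorm w ^+ 2).
Proof.
move=> t0; have h1 : (rnorm z - rnorm w) ^+ 2 <= rnorm (z - w) ^+ 2.
  have := @lipschitz_rnorm R R[i] z w.
  rewrite -(@ler_pXn2r _ 2)// ?nnegrE ?rnorm_ge0//.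
  by rewrite real_normK ?num_real.
have h2 : 2 * (rnorm z * rnorm w) <= t * rnorm z ^+ 2 + t^-1 * rnorm w ^+ 2.
  have : 0 <= t^-1 * (t * rnorm z - rnorm w) ^+ 2.
    by rewrite mulr_ge0 ?sqr_ge0// invr_ge0 ltW.
  rewrite (_ : t^-1 * _ = t * rnorm z ^+ 2 + t^-1 * rnorm w ^+ 2 - 2 * (rnorm z * rnorm w)).
    by rewrite subr_ge0.
  by field; exact: lt0r_neq0.
by move: h1; rewrite sqrrB mulr2n; lra.
Qed.

Section tight_finite_dim.
Context {R : realType} {H : hilbertType R} {Sigma : ptopologicalType}.
Variables (mu : {measure set (borel Sigma) -> \bar R}) (pi : Sigma -> 'B(H)).
Hypothesis Sigma_hausdorff : hausdorff_space Sigma.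
Hypothesis mu_compact : forall L : set Sigma, compact L -> (mu L < +oo)%E.
Hypothesis pi_square_integrable : forall u v : H,
  (\int[mu]_s (rnorm '[pi s u, v] ^+ 2)%:E
    = (rnorm u ^+ 2 * rnorm v ^+ 2)%:E)%E.
Hypothesis pi_continuous : forall u : H,
  continuous (fun s : Sigma => adjoint (pi s) u).
Implicit Types (u v w x : H) (X : set H).

(** Let P project onto the span of a net of the compact set of vectors
    pi(s)^* w, s in L, and v = x - P x. On L the coefficient of v against w is
    small, off L that of x is small, so the two coefficient functions are
    almost orthogonal in L^2; but the isometry property makes their inner
    product |v|^2 |w|^2. The argument is written with nonnegative integrands
    only: |phi(v) - phi(x)|^2 has integral (|x|^2 - |v|^2) |w|^2. *)
Lemma tight_nearly_finite_dim w X (M : R) : w != 0 ->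
  (forall x, X x -> rnorm x <= M) ->
  (forall e : R, 0 < e -> exists2 L : set Sigma, compact L &
    forall x, X x -> phi_tail mu pi w L x <= e) ->
  nearly_finite_dim X.
Proof.
move=> w0 XM Xt e e0.
pose W := rnorm w ^+ 2; have W0 : 0 < W by rewrite exprn_gt0// rnorm_gt0.
have M1 : 0 < M ^+ 2 + 1 by rewrite ltr_wpDl// sqr_ge0.
(* t makes the contribution of the bounded coefficients at most e^2 |w|^2; then
   r, the bound for the small ones, is chosen so that r / t = e^2 |w|^2 / 2. *)
pose t := e ^+ 2 / (2 * (M ^+ 2 + 1)).
have t0 : 0 < t by rewrite divr_gt0 ?exprn_gt0// mulr_gt0.
pose r := t * (e ^+ 2 * W) / 2.
have r0 : 0 < r by rewrite divr_gt0// mulr_gt0// mulr_gt0// exprn_gt0.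
have [L cL LX] := Xt _ r0.
have mL : measurable (L : set (borel Sigma)) by exact: compact_borel.
have mLC := compact_borelC Sigma_hausdorff cL.
pose m := fine (mu L).
have m0 : 0 <= m by rewrite fine_ge0.
have Mm1 : 0 < M ^+ 2 * m + 1 by rewrite ltr_wpDl// mulr_ge0// sqr_ge0.
pose d := Num.min 1 (r / (M ^+ 2 * m + 1)).
have d0 : 0 < d by rewrite lt_min ltr01 divr_gt0.
have [ys Lys] : exists ys : seq H, forall s, L s ->
    exists2 y, y \in ys & rnorm (adjoint (pi s) w - y) < d.
  have : totally_bounded [set adjoint (pi s) w | s in L].
    apply: precompact_totally_bounded; apply: compact_precompact.
      exact: norm_hausdorff.
    apply: continuous_compact cL; apply: continuous_subspaceT.
    exact: pi_continuous.
  by move=> /(_ _ d0)[ys Lys]; exists ys => s Ls; apply: Lys; exists s.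
have [es o esP] := gram_schmidt ys.
exists es => // x Xx; set v := x - projection es x.
have xM := XM _ Xx.
have vx : rnorm v <= rnorm x by exact: rnorm_sub_projection_le.
have vM : rnorm v <= M by exact: le_trans vx xM.
have onL s : L s -> sq (phi pi w v) s <= M ^+ 2 * d.
  move=> /Lys[y yys sy].
  have -> : sq (phi pi w v) s = rnorm '[v, adjoint (pi s) w - y] ^+ 2.
    have vy : '[v, y] = 0 by apply: esP yys; exact: sub_projection_perp.
    by rewrite /sq phiE innerBr vy subr0.
  have : rnorm '[v, adjoint (pi s) w - y] <= M * d.
    rewrite (le_trans (cauchy_schwarz _ _))//.
    by rewrite ler_pM ?rnorm_ge0// ltW.
  have M0 : 0 <= M by exact: le_trans (rnorm_ge0 _) vM.
  rewrite -(@ler_pXn2r _ 2)// ?nnegrE ?rnorm_ge0 ?mulr_ge0 ?(ltW d0)//.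
  move=> /le_trans; apply; rewrite exprMn ler_wpM2l ?sqr_ge0//.
  by rewrite expr2 ler_piMl ?(ltW d0)// ge_min lexx.
have ia u := phi_integrable pi_square_integrable pi_continuous w u.
have iL u := integrable_sub (ia u) mL.
have iLC u := integrable_sub (ia u) mLC.
have aL : \int[mu]_(s in (L : set (borel Sigma))) sq (phi pi w v) s <= r.
  have muL : (mu L < +oo)%E by exact: mu_compact.
  apply: (@le_trans _ _ (\int[mu]_(s in (L : set (borel Sigma))) (M ^+ 2 * d))).
    by apply: le_Rintegral => //; exact: integrable_cst_fin.
  rewrite Rintegral_cst// -/m mulrAC.
  apply: (@le_trans _ _ ((M ^+ 2 * m + 1) * d)).
    by rewrite ler_wpM2r ?(ltW d0)// lerDl.
  by rewrite mulrC -ler_pdivlMr// ge_min lexx orbT.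
have bLC : \int[mu]_(s in ~` (L : set (borel Sigma))) sq (phi pi w x) s <= r.
  exact: LX.
pose I (A : set (borel Sigma)) u := \int[mu]_(s in A) sq (phi pi w u) s.
(* The weight t goes to the coefficient that is only known to be bounded, the
   weight 1/t to the one that is small: v on L, x off L. *)
have IL : I L v + I L x <= I L (v - x) + (t^-1 * I L v + t * I L x).
  apply: le_Rintegral_combination => // s _; rewrite /sq phiB rdistC.
  have := sqr_modulus_sub_ge (phi pi w x s) (phi pi w v s) t0; lra.
have ILC : I (~` L) v + I (~` L) x <=
    I (~` L) (v - x) + (t * I (~` L) v + t^-1 * I (~` L) x).
  apply: le_Rintegral_combination => // s _; rewrite /sq phiB.
  exact: sqr_modulus_sub_ge.
have sv := Rintegral_split (ia v) mL; have sx := Rintegral_split (ia x) mL.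
have sd := Rintegral_split (ia (v - x)) mL.
rewrite !(Rintegral_phi pi_square_integrable) -/W in sv sx sd.
have E : rnorm (v - x) ^+ 2 = rnorm x ^+ 2 - rnorm v ^+ 2.
  rewrite /v addrAC subrr add0r rnormN -(rnorm_projection_sqr x o).
  by rewrite -/v addrK.
have nn u A : 0 <= I A u by apply: Rintegral_ge0 => s _; exact: sq_ge0.
rewrite -/(I L v) -/(I (~` L) v) in sv aL.
rewrite -/(I L x) -/(I (~` L) x) in sx bLC.
rewrite -/(I L (v - x)) -/(I (~` L) (v - x)) E in sd.
have tr : t^-1 * r = e ^+ 2 * W / 2.
  by rewrite /r -mulrA mulKf// gt_eqF.
have h1 : t^-1 * I L v <= e ^+ 2 * W / 2.
  by rewrite -tr ler_wpM2l// invr_ge0 ltW.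
have h2 : t^-1 * I (~` L) x <= e ^+ 2 * W / 2.
  by rewrite -tr ler_wpM2l// invr_ge0 ltW.
have sqM u : rnorm u <= M -> rnorm u ^+ 2 * W <= M ^+ 2 * W.
  move=> uM; rewrite ler_wpM2r ?(ltW W0)// ler_pXn2r// nnegrE ?rnorm_ge0//.
  exact: le_trans (rnorm_ge0 _) uM.
have h3 : t * I L x <= t * (M ^+ 2 * W).
  rewrite ler_wpM2l ?(ltW t0)// (le_trans _ (sqM _ xM))// sx lerDl; exact: nn.
have h4 : t * I (~` L) v <= t * (M ^+ 2 * W).
  rewrite ler_wpM2l ?(ltW t0)// (le_trans _ (sqM _ vM))// sv lerDr; exact: nn.
have h5 : t * (M ^+ 2 * W) *+ 2 <= e ^+ 2 * W.
  have -> : e ^+ 2 * W = t * ((M ^+ 2 + 1) * W) *+ 2.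
    by rewrite /t mulr2n; field; exact: lt0r_neq0.
  by rewrite lerMn2r/= ler_wpM2l ?(ltW t0)// ler_wpM2r ?(ltW W0)// lerDl.
have : rnorm v ^+ 2 * W <= e ^+ 2 * W by rewrite mulr2n in h5; lra.
by rewrite ler_pM2r// ler_pXn2r// nnegrE ?rnorm_ge0// ltW.
Qed.

End tight_finite_dim.

(** * Uniform boundedness and cutoff functions *)

Section realification.
Context {R : realType}.

(** The same vectors with real scalars and a real-valued norm, so that Baire's
    theorem for real Banach spaces applies. *)
Definition realified (V : Type) : Type := V.

Section normed.
Variable V : normedModType R[i].
HB.instance Definition _ := GRing.Zmodule.on (realified V).

Definition rscale (a : R) (v : realified V) : realified V := a%:C *: (v : V).
Lemma rscaleA a b v : rscale a (rscale b v) = rscale (a * b) v.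
Proof. by rewrite /rscale scalerA rmorphM. Qed.
Lemma rscale1 : left_id 1 rscale.
Proof. by move=> v; rewrite /rscale rmorph1 scale1r. Qed.
Lemma rscaleDr : right_distributive rscale +%R.
Proof. by move=> a u v; rewrite /rscale scalerDr. Qed.
Lemma rscaleDl v : {morph rscale^~ v : a b / a + b}.
Proof. by move=> a b; rewrite /rscale rmorphD scalerDl. Qed.
HB.instance Definition _ := GRing.Zmodule_isLmodule.Build R (realified V)
  rscaleA rscale1 rscaleDr rscaleDl.

Definition realified_norm (v : realified V) : R := rnorm (v : V).
Lemma realified_normD u v :
  realified_norm (u + v) <= realified_norm u + realified_norm v.
Proof. exact: rnormD. Qed.
Lemma realified_normZ (a : R) v : realified_norm (a *: v) = `|a| * realified_norm v.
Proof.
change (rnorm (a%:C *: (v : V)) = `|a| * rnorm (v : V)).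
by rewrite rnormZ rnormR.
Qed.
Lemma realified_norm0_eq0 v : realified_norm v = 0 -> v = 0.
Proof. exact: rnorm0_eq0. Qed.
HB.instance Definition _ := @Lmodule_isNormed.Build R (realified V)
  realified_norm realified_normD realified_normZ realified_norm0_eq0.
End normed.

Lemma realified_complete (V : completeNormedModType R[i])
  (F : set_system (realified V)) : ProperFilter F -> cauchy F -> cvg F.
Proof.
move=> FF /cauchyP Fc.
have : cauchy (F : set_system V).
  apply: cauchy_exP => _ /posC_exists[e e0 ->].
  have [x Fx] := Fc e e0; exists x; apply: filterS Fx => y xy.
  rewrite ball_rnorm; move: xy; rewrite -(@ball_normE R (realified V)); exact.
move=> /cauchy_cvg/cvg_ex[/= x Fx]; apply/cvg_ex; exists x => A.
move=> /nbhs_ballP[e /= e0 xA]; apply: Fx; apply/nbhs_rnormP; exists e => //.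
Qed.
HB.instance Definition _ (V : completeNormedModType R[i]) :=
  Uniform_isComplete.Build (realified V) (@realified_complete V).

(** The uniform boundedness principle is inherited from the underlying real
    Banach space. *)
Lemma uniform_boundedness (V : completeNormedModType R[i]) (W : normedModType R[i])
    (F : set 'B(V, W)) :
  (forall x, exists M : R, forall A, F A -> rnorm (A x) <= M) ->
  exists2 M : R, 0 <= M & forall A, F A -> rnorm A <= M.
Proof.
move=> Fx.
pose G : set (realified V -> realified W) := [set bop_fun A | A in F].
have Gx : pointwise_bounded G.
  by move=> x; have [M FM] := Fx x; exists M => _ [A FA <-]; exact: FM.
have GP f : G f -> bounded_fun_norm f /\ linear f.
  move=> [A FA <-]; split=> [r|a x y]; last exact: (bop_linear A a%:C x y).
  exists (rnorm A * r) => x xr; apply: (le_trans (bop_le A x)).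
  by rewrite ler_wpM2l// rnorm_ge0.
have [M MG] := Banach_Steinhauss GP Gx (1 : R).
exists `|M| => // A FA; apply: rnorm_bop_le => x x1.
by apply: le_trans (ler_norm M); apply: (MG A) x1; exists A.
Qed.

End realification.

Section cutoff.
Context {R : realType} {S : topologicalType}.

Let trunc2_lipschitz (a b : R) :
  `|Num.max 0 (2 * a - 1) - Num.max 0 (2 * b - 1)| <= 2 * `|a - b|.
Proof.
have h : forall x y : R, Num.max 0 x - Num.max 0 y <= `|x - y|.
  move=> x y; have := ler_norm (x - y); have := normr_ge0 (x - y).
  by case: (lerP 0 x); case: (lerP 0 y); lra.
have -> : 2 * `|a - b| = `|2 * a - 1 - (2 * b - 1)|.
  by rewrite opprB addrA addrNK -mulrBr normrM ger0_norm.
by rewrite ler_norml lerNl opprB [in X in X && _]distrC !h.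
Qed.

(** Urysohn's lemma on the one-point compactification separates L from the
    point at infinity; halving the range makes the support compact. *)
Lemma compact_cutoff (L : set S) : hausdorff_space S ->
  locally_compact [set: S] -> compact L ->
  exists f : S -> R, [/\ continuous f, forall s, 0 <= f s <= 1,
    forall s, L s -> f s = 1 & compact (closure [set s | f s != 0])].
Proof.
move=> hS lS cL; pose S' := one_point_compactification S.
have hS' : hausdorff_space S' by exact: one_point_compactification_hausdorff.
have cS' : compact [set: S'] by exact: one_point_compactification_compact.
have nS' : normal_space S' by exact: compact_normal.
pose Some' : S -> S' := Some.
have cSome : continuous Some' by exact: one_point_compactification_some_continuous.
have cL' : closed (Some' @` L).
  by apply: compact_closed => //; apply: continuous_compact cL; exact: continuous_subspaceT.
have cN : closed [set (None : S')].
  by apply: accessible_closed_set1; exact: hausdorff_accessible.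
have LN : [set (None : S')] `&` Some' @` L = set0.
  by rewrite -subset0 => _ [/= -> [s]].
have [g [cg g01 gN gL]] := (@uniform_separatorP _ R _ _).1
  ((@normal_separatorP R _).1 nS' _ _ cN cL' LN).
(* Where f is nonzero, g exceeds 1/2, hence f vanishes near infinity. *)
pose f s : R := Num.max 0 (2 * g (Some' s) - 1).
have gr s : 0 <= g s <= 1.
  by have := g01 (g s); rewrite /= in_itv/=; apply; exists s.
have cgS : continuous (g \o Some').
  by move=> s; apply: continuous_comp; [exact: cSome|exact: cg].
exists f; split.
- move=> s; apply/cvgrPdist_lt => e e0.
  have e20 : 0 < e / 2 by rewrite divr_gt0.
  have /cvgrPdist_lt/(_ _ e20) := cgS s; apply: filterS => t st.
  apply: le_lt_trans (trunc2_lipschitz _ _) _.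
  by rewrite mulrC -ltr_pdivlMr.
- move=> s; have /andP[g0 g1] := gr (Some' s).
  by rewrite le_max lexx ge_max ler01/=; lra.
- move=> s Ls; have -> : f s = Num.max 0 (2 * 1 - 1).
    by rewrite /f (gL (g (Some' s)))//; exists (Some' s) => //; exists s.
  by rewrite mulr1 (_ : 2 - 1 = 1) ?max_r//; lra.
have [C [cC clC] CP] : exists2 C : set S, compact C /\ closed C &
    forall s, ~ C s -> g (Some' s) < 2^-1.
  have gN0 : g None = 0 by apply: gN; exists None.
  have : nbhs (None : S') [set x | g x < 2^-1].
    apply: (cg None [set y | y < 2^-1]); rewrite gN0.
    by apply: open_nbhs_nbhs; split; [exact: open_lt|rewrite /= invr_gt0].
  move=> [C [cC clC] CU]; exists C => // s nCs.
  by apply: CU; left; exists s.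
apply: (subclosed_compact (@closed_closure _ _) cC).
rewrite closureE; apply: smallest_sub => // s /=; apply: contraNP => /CP gs.
by rewrite /f max_l//; lra.
Qed.

End cutoff.

(** * Tensors, Hilbert-Schmidt norms and the transform Phi *)

Section tensors.
Context {R : realType} {H : hilbertType R}.
Variable HH : hilbert_tensor H (conjugate H).
Implicit Types (t : HH) (u v x : H) (s : seq (H * conjugate H)).

Definition finite_tensor s : HH := \sum_(p <- s) tens HH p.1 p.2.

Lemma finite_tensor_approx t (e : R) : 0 < e ->
  exists s, rnorm (t - finite_tensor s) < e.
Proof.
move=> e0; have [||y [ty [s _ sy]]] := @dense_tens _ _ _ HH (ball t e%:C).
- by exists t; apply: ballxx; rewrite ltcR.
- exact: ball_open.
by exists s; rewrite -ball_rnorm /finite_tensor sy.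
Qed.

Lemma inner_tensor u v u' v' :
  '[tens HH u v, tens HH u' v'] = '[u, u'] * '[v', v].
Proof. exact: inner_tens. Qed.

Lemma rnorm_tensor u v : rnorm (tens HH u v) = rnorm u * rnorm v.
Proof.
apply/eqP; rewrite -(@eqrXn2 _ 2)// ?mulr_ge0 ?rnorm_ge0//.
rewrite rnorm_sqr inner_tensor !inner_rnorm ReZ/=.
by rewrite exprMn.
Qed.

End tensors.

Section hilbert_schmidt_norm.
Context {R : realType} {H : hilbertType R}.

Lemma rnorm_le_HS (A : 'B(H)) (M : R) : 0 <= M ->
  (HS_norm2 A <= (M ^+ 2)%:E)%E -> rnorm A <= M.
Proof.
move=> M0 AM; apply: rnorm_bop_le_scale => // x.
have [->|x0] := eqVneq x 0; first by rewrite bop0 !rnorm0 mulr0.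
have nx := rnorm_gt0 x0; pose e := (rnorm x)^-1%:C *: x.
have xE : x = (rnorm x)%:C *: e.
  by rewrite /e scalerA -rmorphM/= mulfV ?gt_eqF// scale1r.
have e1 : '[e, e] = 1.
  rewrite /e innerZl innerZr inner_rnorm conjc_real -!rmorphM/=.
  by rewrite expr2 mulKf ?gt_eqF// mulVf// gt_eqF.
have Ae : rnorm (A e) <= M.
  rewrite -(@ler_pXn2r _ 2)// ?nnegrE ?rnorm_ge0//.
  rewrite -lee_fin (le_trans _ AM)//; apply: ereal_sup_ubound.
  exists [:: e]; last by rewrite big_seq1.
  by apply/orthonormal_cons; split.
by rewrite {1}xE bopZ rnormZ rnormR ger0_norm ?rnorm_ge0// mulrC ler_wpM2r ?rnorm_ge0.
Qed.

End hilbert_schmidt_norm.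

Section transform.
Context {R : realType} {H : hilbertType R} {Sigma : ptopologicalType}.
Variables (mu : {measure set (borel Sigma) -> \bar R}) (pi : Sigma -> 'B(H)).
Variable HH : hilbert_tensor H (conjugate H).
Variable Phi : HH -> Sigma -> R[i].
Hypothesis PhiP : is_Phi mu pi Phi.
Implicit Types (t : HH) (u v x : H).

Lemma ae_mono2 (P Q C : Sigma -> Prop) : (forall s, P s -> Q s -> C s) ->
  {ae mu, forall s, P s} -> {ae mu, forall s, Q s} -> {ae mu, forall s, C s}.
Proof. exact: (@filterS2 _ _ (ae_filter_ringOfSetsType mu)). Qed.

Lemma ae_mono (P Q : Sigma -> Prop) : (forall s, P s -> Q s) ->
  {ae mu, forall s, P s} -> {ae mu, forall s, Q s}.
Proof. exact: (@filterS _ _ (ae_filter_ringOfSetsType mu)). Qed.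

Lemma Phi_integrable t : mu.-integrable setT (EFin \o sq (Phi t)).
Proof. by have [PL2 _ _ _] := PhiP; exact: L2_integrable. Qed.

Lemma Rintegral_Phi t : \int[mu]_s sq (Phi t) s = rnorm t ^+ 2.
Proof.
have [_ _ PN _] := PhiP; rewrite /Rintegral.
have := L2norm_sqr mu (Phi t); rewrite PN poweR_EFin (powR_mulrn 2) ?rnorm_ge0//.
by move=> <-.
Qed.

Lemma Phi_sub t t' : {ae mu, forall s, Phi (t - t') s = Phi t s - Phi t' s}.
Proof.
have [_ Pl _ _] := PhiP; have := Pl (-1) t' t; apply: ae_mono => s.
by rewrite scaleN1r addrC => ->; rewrite mulN1r addrC.
Qed.

Lemma Phi_add t t' : {ae mu, forall s, Phi (t + t') s = Phi t s + Phi t' s}.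
Proof.
have [_ Pl _ _] := PhiP; have := Pl 1 t t'; apply: ae_mono => s.
by rewrite scale1r mul1r.
Qed.

Lemma Phi0 : {ae mu, forall s, Phi 0 s = 0}.
Proof. by have := Phi_sub 0 0; apply: ae_mono => s; rewrite !subrr. Qed.

Lemma Phi_finite_tensor l :
  {ae mu, forall s, Phi (finite_tensor HH l) s = \sum_(p <- l) phi pi p.2 p.1 s}.
Proof.
rewrite /finite_tensor; elim: l => [|p l IH].
  by rewrite big_nil; apply: ae_mono Phi0 => s ->; rewrite big_nil.
have [_ _ _ Pt] := PhiP; rewrite big_cons.
have := ae_mono2 (fun s => @conj _ _) IH (Pt p.1 p.2).
move: (Phi_add (tens HH p.1 p.2) (\sum_(j <- l) tens HH j.1 j.2)).
by apply: ae_mono2 => s -> [-> ->]; rewrite big_cons.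
Qed.

(** Isometry of Phi, for an arbitrary representative g of the class. *)
Lemma rnorm_eq_Phi t (g : Sigma -> R[i]) : measurable_fun setT (sq g : borel Sigma -> R) ->
  {ae mu, forall s, Phi t s = g s} -> rnorm t ^+ 2 = \int[mu]_s sq g s.
Proof.
move=> mg tg; rewrite -Rintegral_Phi; apply: ae_eq_Rintegral_sq => //.
by have /integrableP[/measurable_EFinP] := Phi_integrable t.
Qed.

Lemma sq_integrable_Phi t (g : Sigma -> R[i]) :
  measurable_fun setT (sq g : borel Sigma -> R) ->
  {ae mu, forall s, Phi t s = g s} -> mu.-integrable setT (EFin \o sq g).
Proof. by move=> mg; apply: ae_eq_integrable_sq => //; exact: Phi_integrable. Qed.

Lemma L2_EFin (r : Sigma -> R) : measurable_fun setT (r : borel Sigma -> R) ->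
  (\int[mu]_s (r s ^+ 2)%:E < +oo)%E -> L2 mu (fun s => (r s)%:C).
Proof.
move=> mr roo; apply: L2P => //=.
by under eq_integral do rewrite /sq rnormR real_normK ?num_real//.
Qed.

Lemma L2_Cc (f : Sigma -> R[i]) : hausdorff_space Sigma ->
  (forall L : set Sigma, compact L -> (mu L < +oo)%E) -> Cc f -> L2 mu f.
Proof.
move=> hS muc [cf sf].
have csq := sq_continuous cf.
apply: L2P.
- exact: (continuous_borel (@continuous_lipschitz R Sigma R[i]^o (@complex.Re R) f (@lipschitz_Re R) cf)).
- exact: (continuous_borel (@continuous_lipschitz R Sigma R[i]^o (@complex.Im R) f (@lipschitz_Im R) cf)).
pose L := closure [set s | f s != 0].
have mL : measurable (L : set (borel Sigma)) by exact: compact_borel.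
have : compact (sq f @` L).
  by apply: continuous_compact sf; exact: continuous_subspaceT.
move=> /compact_bounded [M [_ /(_ (M + 1))]]; rewrite ltrDl ltr01 => /(_ isT) fM.
have fle s : ((sq f s)%:E <= ((M + 1)%:E * (\1_L s)%:E))%E.
  rewrite indicE; have [sL|sL] := boolP (s \in L).
    rewrite mule1 lee_fin -[leLHS]ger0_norm ?sq_ge0//; apply: fM.
    by exists s => //; exact: set_mem.
  rewrite mule0 lee_fin /sq; have -> : f s = 0.
    apply/eqP; apply: contraNT sL => fs; apply: mem_set.
    exact: (@subset_closure _ [set s | f s != 0]).
  by rewrite rnorm0 expr0n.
apply: (@le_lt_trans _ _ (\int[mu]_s ((M + 1)%:E * (\1_L s)%:E))%E).
  apply: ge0_le_integral => //.
  - by move=> s _; rewrite lee_fin sq_ge0.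
  - by apply/measurable_EFinP; exact: (continuous_borel csq).
  - apply: measurable_funeM; apply/measurable_EFinP; exact: measurable_indic.
rewrite integralZl//; last first.
  apply/integrableP; split; first by apply/measurable_EFinP; exact: measurable_indic.
  under eq_integral do rewrite gee0_abs ?lee_fin//.
  by rewrite integral_indic// setIT; exact: muc.
rewrite integral_indic// setIT -(@fineK _ (mu L)) ?ltry//.
by rewrite ge0_fin_numE//; exact: muc.
Qed.

End transform.

(** * Approximation by the symbolic calculus *)

Section symbolic_calculus.
Context {R : realType} {H : hilbertType R} {Sigma : ptopologicalType}.
Variables (mu : {measure set (borel Sigma) -> \bar R}) (pi : Sigma -> 'B(H)).
Hypothesis Sigma_hausdorff : hausdorff_space Sigma.
Hypothesis Sigma_lc : locally_compact [set: Sigma].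
Hypothesis Sigma_sc : sigma_compact Sigma.
Hypothesis mu_compact : forall L : set Sigma, compact L -> (mu L < +oo)%E.
Hypothesis pi_continuous : forall u : H,
  continuous (fun s : Sigma => adjoint (pi s) u).
Variable HH : hilbert_tensor H (conjugate H).
Variable Phi : HH -> Sigma -> R[i].
Hypothesis PhiP : is_Phi mu pi Phi.
Hypothesis Phi_surjective : L2_surjective mu Phi.
Variable Lambda : {linear HH -> 'B(H)}.
Hypothesis LambdaP : is_Lambda Lambda.
Implicit Types (t : HH) (u v x : H) (K : set 'B(H)).

Lemma rnorm_Lambda_le t : rnorm (Lambda t) <= rnorm t.
Proof.
have [_ LN _] := LambdaP.
by apply: rnorm_le_HS; [exact: rnorm_ge0|rewrite LN].
Qed.

Lemma Lambda_finite_tensor l x :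
  Lambda (finite_tensor HH l) x = \sum_(p <- l) '[x, p.2 : H] *: p.1.
Proof.
have [Lt _ _] := LambdaP; rewrite /finite_tensor raddf_sum sum_bopE.
by apply: eq_bigr => p _; rewrite Lt.
Qed.

Lemma Pi_Phi (f : Sigma -> R[i]) : L2 mu f ->
  exists2 t, Pi mu Phi Lambda f = Lambda t & {ae mu, forall s, Phi t s = f s}.
Proof.
move=> fL2; have [t0 t0f] := Phi_surjective fL2.
exists (xget 0 [set t | {ae mu, forall s, Phi t s = f s}]) => //.
have := @xgetPex _ 0 [set t | {ae mu, forall s, Phi t s = f s}].
by apply; exists t0.
Qed.

(** The projection P onto a finite-dimensional space is the operator with
    symbol s |-> trace of pi(s) P, a continuous square integrable function;
    a compactly supported truncation of the symbol changes the operator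
    little, in Hilbert-Schmidt norm. *)
Lemma projection_symbol (es : seq H) (e : R) : 0 < e ->
  exists2 f : Sigma -> R[i], Cc f & rnorm (Pi mu Phi Lambda f - projection es) <= e.
Proof.
move=> e0; pose l : seq (H * conjugate H) := [seq (a, a) | a <- es].
pose p s := \sum_(a <- es) phi pi a a s.
have cp : continuous (p : Sigma -> R[i]^o).
  rewrite /p; elim: (es) => [|a as' IH].
    apply/continuous_rnormP => s d d0; apply: nearW => t.
    by rewrite !big_nil subrr rnorm0.
  move=> s; rewrite (_ : (fun s => _) =
    (fun s => (phi pi a a s : R[i]^o) + (\sum_(b <- as') phi pi b b s : R[i]^o))).
    by apply: cvgD; [exact: phi_continuous|exact: IH].
  by apply/funext => z; rewrite big_cons.
have Pp : {ae mu, forall s, Phi (finite_tensor HH l) s = p s}.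
  by apply: ae_mono (Phi_finite_tensor PhiP l) => s ->; rewrite /l big_map.
have msq (g : Sigma -> R[i]) : continuous (g : Sigma -> R[i]^o) ->
    measurable_fun setT (sq g : borel Sigma -> R).
  by move=> cg; exact: (continuous_borel (sq_continuous cg)).
have ip : mu.-integrable setT (EFin \o sq p).
  exact: (sq_integrable_Phi PhiP (msq _ cp) Pp).
have [|L cL Lp] := integrable_compact_tail Sigma_hausdorff Sigma_sc ip (sq_ge0 _)
  (e := e ^+ 2); first by rewrite exprn_gt0.
have [chi [cchi chi01 chiL chis]] := compact_cutoff Sigma_hausdorff Sigma_lc cL (R := R).
pose f s := (chi s)%:C * p s.
have cf : continuous (f : Sigma -> R[i]^o).
  have cc : continuous (fun s => (chi s)%:C : R[i]^o).
    apply/continuous_rnormP => s d d0.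
    have /cvgrPdist_lt/(_ _ d0) := cchi s; apply: filterS => t.
    by rewrite -rmorphB [rnorm _]rnormR.
  by move=> s; apply: cvgM; [exact: cc|exact: cp].
have fCc : Cc f.
  split => //; apply: (subclosed_compact _ chis); first exact: closed_closure.
  apply: closureS => s /=; apply: contra_neq => cs.
  by rewrite /f cs mul0r.
exists f => //.
have [t -> tf] := Pi_Phi (L2_Cc Sigma_hausdorff mu_compact fCc).
have -> : projection es = Lambda (finite_tensor HH l).
  apply: bopP => x; rewrite projectionE Lambda_finite_tensor /l big_map.
  by [].
rewrite -raddfB (le_trans (rnorm_Lambda_le _))//.
rewrite -(@ler_pXn2r _ 2)// ?nnegrE ?rnorm_ge0 ?(ltW e0)//.
pose g s := f s - p s.
have cg : continuous (g : Sigma -> R[i]^o) by move=> s; apply: cvgB; [exact: cf|exact: cp].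
have tg : {ae mu, forall s, Phi (t - finite_tensor HH l) s = g s}.
  have := ae_mono2 (fun s => @conj _ _) tf Pp.
  by move: (Phi_sub PhiP t (finite_tensor HH l)); apply: ae_mono2 => s -> [-> ->].
have ig := sq_integrable_Phi PhiP (msq _ cg) tg.
have mL : measurable (L : set (borel Sigma)) by exact: compact_borel.
have mLC := compact_borelC Sigma_hausdorff cL.
rewrite (rnorm_eq_Phi PhiP (msq _ cg) tg) (Rintegral_split ig mL).
rewrite (@eq_Rintegral _ _ _ mu L (fun=> 0)); last first.
  move=> s /set_mem sL; rewrite /sq /g /f chiL//.
  by rewrite mul1r subrr rnorm0 expr0n.
rewrite Rintegral_cst// mul0r add0r; apply: le_trans Lp.
apply: le_Rintegral => //; [exact: integrable_sub|exact: integrable_sub|].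
move=> s _; rewrite /sq ler_pXn2r// ?nnegrE ?rnorm_ge0//.
rewrite /g /f -[X in _ - X]mul1r -mulrBl rnormM -(rmorphB _ (chi s) 1)/= rnormR.
have /andP[c0 c1] := chi01 s.
by rewrite ler_piMl ?rnorm_ge0// ler_norml; lra.
Qed.

Lemma nearly_finite_dim_symbol K (M : R) :
  (forall S, K S -> rnorm S <= M) -> nearly_finite_dim (unit_images K) ->
  forall e : R, 0 < e -> exists2 f : Sigma -> R[i], Cc f &
    (ereal_sup [set (rnorm ((Pi mu Phi Lambda f - bop_id H) \oB S))%:E
      | S in K] <= e%:E)%E.
Proof.
move=> KM Kf e e0; have e20 : 0 < e / 2 by rewrite divr_gt0.
have [es o esP] := Kf _ e20.
have M1 : 0 < `|M| + 1 by rewrite ltr_wpDl.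
have [|f fCc fP] := @projection_symbol es (e / 2 / (`|M| + 1)).
  by rewrite divr_gt0.
exists f => //; apply: ge_ereal_sup => _ [S KS <-].
rewrite lee_fin; apply: rnorm_bop_le => x x1.
set A := Pi mu Phi Lambda f in fP *.
change (rnorm (A (S x) - S x) <= e).
rewrite (le_trans (rdist_triangle (projection es (S x)) _ _))// (splitr e) lerD//.
  rewrite -bop_subE (le_trans (bop_le _ _))//.
  apply: (@le_trans _ _ (e / 2 / (`|M| + 1) * (`|M| + 1))).
    rewrite ler_pM ?rnorm_ge0// (le_trans (bop_le_ball _ x1))//.
    by rewrite (le_trans (KM _ KS))// (le_trans (ler_norm M))// lerDl.
  by rewrite divfK// gt_eqF.
by rewrite rdistC; apply: esP; exists S, x.
Qed.

(** Pi f comes from a tensor; replacing that tensor by a nearby finite sum of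
    elementary ones replaces Pi f by a nearby operator of finite rank. *)
Lemma symbol_nearly_finite_dim K (M : R) :
  (forall S, K S -> rnorm S <= M) ->
  (forall e : R, 0 < e -> exists2 f : Sigma -> R[i], Cc f &
    (ereal_sup [set (rnorm ((Pi mu Phi Lambda f - bop_id H) \oB S))%:E
      | S in K] <= e%:E)%E) ->
  nearly_finite_dim (unit_images K).
Proof.
move=> KM Kf e e0; have e20 : 0 < e / 2 by rewrite divr_gt0.
have M1 : 0 < `|M| + 1 by rewrite ltr_wpDl.
have [f _ fP] := Kf _ e20.
pose t := xget 0 [set t | {ae mu, forall s, Phi t s = f s}].
have [|l tl] := @finite_tensor_approx _ _ HH t (e / 2 / (`|M| + 1)).
  by rewrite divr_gt0.
have [es o esP] := gram_schmidt [seq p.1 | p <- l].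
exists es => // _ [S [u [KS u1 ->]]]; set x := S u.
have xM : rnorm x <= `|M| + 1.
  rewrite (le_trans (bop_le_ball _ u1))// (le_trans (KM _ KS))//.
  by rewrite (le_trans (ler_norm M))// lerDl.
apply: (@le_trans _ _ (rnorm (x - Lambda (finite_tensor HH l) x))).
  apply: sub_projection_min => //.
  rewrite Lambda_finite_tensor inner_suml big_seq big1// => p pl.
  have xp : '[x - projection es x, p.1] = 0.
    by apply: esP; [exact: sub_projection_perp|exact: map_f].
  by rewrite innerZl (innerC p.1) xp rmorph0 mulr0.
rewrite (le_trans (rdist_triangle (Lambda t x) _ _))// (splitr e) lerD//.
  rewrite rdistC -lee_fin; apply: le_trans fP.
  apply: (@le_trans _ _ (rnorm ((Lambda t - bop_id H) \oB S))%:E).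
    by rewrite lee_fin; exact: (bop_le_ball ((Lambda t - bop_id H) \oB S) u1).
  by apply: ereal_sup_ubound; exists S.
rewrite -bop_subE -raddfB (le_trans (bop_le _ _))//.
apply: (@le_trans _ _ (e / 2 / (`|M| + 1) * (`|M| + 1))).
  rewrite ler_pM ?rnorm_ge0// (le_trans (rnorm_Lambda_le _))// ltW//.
by rewrite divfK// gt_eqF.
Qed.

End symbolic_calculus.

(** * Equicontinuity *)

Lemma equicontinuous_rnormP {R : realType} (S : topologicalType)
    (V : normedModType R[i]) (I : Type) (W : set I) (g : I -> S -> V) :
  equicontinuous W g <-> forall s (e : R), 0 < e ->
    \forall t \near s, forall i, W i -> rnorm (g i s - g i t) < e.
Proof.
split=> Wg s.
  move=> e e0; have e0C : 0 < (e%:C : R[i]) by rewrite ltcR.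
  have := Wg s _ (entourage_ball V (PosNum e0C)); apply: filterS => t + i Wi.
  by move=> /(_ i Wi); rewrite /= -ball_rnorm.
move=> E; rewrite -entourage_ballE => -[_ /= /posC_exists[e e0 ->] EE].
by apply: filterS (Wg s e e0) => t st i Wi; apply: EE; rewrite /= ball_rnorm; exact: st.
Qed.

Section averaging.
Context {R : realType} {H : hilbertType R} {Sigma : ptopologicalType}.
Variables (mu : {measure set (borel Sigma) -> \bar R}) (pi : Sigma -> 'B(H)).
Hypothesis Sigma_hausdorff : hausdorff_space Sigma.
Hypothesis Sigma_lc : locally_compact [set: Sigma].
Hypothesis mu_compact : forall L : set Sigma, compact L -> (mu L < +oo)%E.
Implicit Types (u v x : H) (K : set 'B(H)).

Lemma compact_neighbourhood (s : Sigma) : exists2 L : set Sigma, compact L & nbhs s L.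
Proof.
have [//|L + [cL _]] := @Sigma_lc s; rewrite withinET => sL.
by exists L.
Qed.

Section upper.
Hypothesis pi_continuous : forall u : H,
  continuous (fun s : Sigma => adjoint (pi s) u).

Lemma adjoint_locally_bounded (L : set Sigma) : compact L ->
  exists2 M : R, 0 <= M & forall s, L s -> rnorm (adjoint (pi s)) <= M.
Proof.
move=> cL; have [|M M0 LM] := @uniform_boundedness R H H
    [set adjoint (pi s) | s in L].
  move=> x; have : totally_bounded [set adjoint (pi s) x | s in L].
    apply: precompact_totally_bounded; apply: compact_precompact.
      exact: norm_hausdorff.
    apply: continuous_compact cL; apply: continuous_subspaceT.
    exact: pi_continuous.
  move=> /totally_bounded_bounded[M _ MP]; exists M => _ [s Ls <-].
  by apply: MP; exists s.
by exists M => // s Ls; apply: LM; exists s.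
Qed.

(** On a finite net strong continuity suffices; the local bound on the norms of
    the adjoints extends the estimate to all images of the unit ball. *)
Lemma totally_bounded_equicontinuous K : totally_bounded (unit_images K) ->
  equicontinuous K (fun S (s : Sigma) => adjoint (pi s) \oB S).
Proof.
move=> Ktb; apply/equicontinuous_rnormP => s e e0.
have [L cL sL] := compact_neighbourhood s.
have Ls : L s by exact: nbhs_singleton.
have [M M0 LM] := adjoint_locally_bounded cL.
have M1 : 0 < 4 * (M + 1) by rewrite mulr_gt0// ltr_wpDl.
have [|l Kl] := Ktb (e / (4 * (M + 1))); first by rewrite divr_gt0.
have e40 : 0 < e / 4 by rewrite divr_gt0.
have near_l : \forall t \near s,
    {in l, forall a, rnorm (adjoint (pi s) a - adjoint (pi t) a) < e / 4}.
  elim: (l) => [|a m IH]; first by apply: nearW.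
  have /continuous_rnormP/(_ s _ e40) := @pi_continuous a.
  move: IH; apply: filterS2 => t tm ta b; rewrite inE => /orP[/eqP->//|].
  exact: tm.
move: sL near_l; apply: filterS2 => t Lt tl S KS.
apply: (@le_lt_trans _ _ (e * 3 / 4)); last by lra.
apply: rnorm_bop_le => u u1.
change (rnorm (adjoint (pi s) (S u) - adjoint (pi t) (S u)) <= e * 3 / 4).
have [|a al ua] := Kl (S u); first by exists S, u.
have diff (r : Sigma) : L r -> rnorm (adjoint (pi r) (S u) - adjoint (pi r) a) <= e / 4.
  move=> Lr; rewrite -bopB (le_trans (bop_le _ _))//.
  apply: (@le_trans _ _ ((M + 1) * (e / (4 * (M + 1))))).
    rewrite ler_pM ?rnorm_ge0// ?(ltW ua)// (le_trans (LM _ Lr))// lerDl//.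
  rewrite le_eqVlt; apply/orP; left; apply/eqP; field.
  by rewrite gt_eqF// ltr_wpDl.
have h1 := diff _ Ls; have h2 := diff _ Lt; have h3 := tl _ al.
have h4 := rdist_triangle (adjoint (pi s) a) (adjoint (pi s) (S u)) (adjoint (pi t) (S u)).
have h5 := rdist_triangle (adjoint (pi t) a) (adjoint (pi s) a) (adjoint (pi t) (S u)).
rewrite rdistC in h2; lra.
Qed.

End upper.

Variable HH : hilbert_tensor H (conjugate H).
Variable Phi : HH -> Sigma -> R[i].
Hypothesis PhiP : is_Phi mu pi Phi.
Hypothesis Phi_surjective : L2_surjective mu Phi.

(** Under Lambda this tensor becomes the average of pi(s)^* over U. Being the
    limit of finite sums of elementary tensors, it makes that average a norm
    limit of operators of finite rank. *)
Lemma indicator_tensor (U : set Sigma) : open U -> (0 < mu U < +oo)%E ->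
  let m := fine (mu U) in
  exists2 t : HH, rnorm t ^+ 2 = m^-1 &
    {ae mu, forall s, Phi t s = (m^-1 * \1_U s)%:C}.
Proof.
move=> oU /andP[mU0 mUoo] m.
have mU : measurable (U : set (borel Sigma)) by exact: open_borel.
have m0 : 0 < m by rewrite fine_gt0// mU0.
have mE : mu U = m%:E by rewrite /m fineK// ge0_fin_numE// ltW.
pose g (s : Sigma) : R := m^-1 * \1_U s.
have mg : measurable_fun setT (g : borel Sigma -> R).
  by apply: measurable_funM => //; exact: measurable_indic.
have sqE : sq (fun s => (g s)%:C) = (fun s => (m^-1) ^+ 2 * \1_U s).
  apply/funext => s; rewrite /sq rnormR real_normK ?num_real// /g indicE exprMn.
  by case: (s \in U) => /=; rewrite ?expr1n ?expr0n.
have iU : mu.-integrable setT (EFin \o (\1_U : borel Sigma -> R)).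
  apply: ge0_integrable; first exact: measurable_indic.
    by move=> s; rewrite indicE.
  by rewrite integral_indic// setIT.
have isq : mu.-integrable setT (EFin \o sq (fun s => (g s)%:C)).
  rewrite sqE; exact: (integrableZl _ ((m^-1) ^+ 2) iU).
have [|t tg] := Phi_surjective (f := fun s => (g s)%:C).
  apply: L2_EFin => //; have /integrableP[_] := isq.
  under eq_integral do rewrite /= ger0_norm ?sq_ge0// /sq rnormR real_normK ?num_real//.
  by [].
exists t => //; rewrite (rnorm_eq_Phi PhiP _ tg); last first.
  by have /integrableP[/measurable_EFinP] := isq.
rewrite sqE RintegralZl// /Rintegral integral_indic// setIT -/m.
by rewrite expr2 -mulrA mulVf ?mulr1// gt_eqF.
Qed.

Lemma support_open_neighbourhood (s : Sigma) (A : set Sigma) :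
  measure_support mu s -> nbhs s A ->
  exists U : set Sigma, [/\ open U, U `<=` A & (0 < mu U < +oo)%E].
Proof.
move=> sup sA; have [L cL sL] := compact_neighbourhood s.
have : nbhs s (A `&` L) by exact: filterI.
rewrite nbhsE => -[U [oU Us] UAL]; exists U; split => //.
  by move=> x /UAL[].
rewrite sup//=; apply: le_lt_trans (mu_compact cL).
apply: le_measure; rewrite ?inE; last by move=> x /UAL[].
  exact: open_borel.
exact: compact_borel.
Qed.

(** A neighbourhood of s1 carries a nonzero square integrable function, which
    would be the image of a tensor over the zero space. *)
Lemma nontrivial_space (s1 : Sigma) : measure_support mu s1 ->
  exists w : H, w != 0.
Proof.
move=> sup; apply: contrapT => H0.
have all0 (u : H) : u = 0.
  by apply/eqP; apply: contrapT => u0; apply: H0; exists u; apply/negP.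
have [|U [oU _ mU]] := support_open_neighbourhood sup (A := setT).
  exact: filterT.
have [t tm _] := indicator_tensor oU mU.
have : rnorm t = 0.
  apply/eqP; rewrite eq_le rnorm_ge0 andbT; apply/ler_addgt0Pr => e e0.
  have [l tl] := finite_tensor_approx t e0; rewrite add0r.
  rewrite (_ : finite_tensor HH l = 0) ?subr0 in tl; first exact: ltW.
  rewrite /finite_tensor big1// => p _; apply: rnorm0_eq0.
  by rewrite rnorm_tensor (all0 p.1) rnorm0 mul0r.
move=> t0; move: tm; rewrite t0 expr0n/= => /esym/eqP; rewrite invr_eq0.
by rewrite gt_eqF// fine_gt0.
Qed.

(** The inner product of the normalized indicator t of U with y = v (x) x is the
    average over U of the conjugate of the coefficient of v against x, and so
    inherits its lower bound. It is evaluated by polarization, through the norm of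
    t - y, so that all integrands are nonnegative. *)
Lemma average_inner (U : set Sigma) (t : HH) (v x : H) (c : R) :
  open U -> (0 < mu U < +oo)%E -> 0 <= c ->
  rnorm t ^+ 2 = (fine (mu U))^-1 ->
  {ae mu, forall s, Phi t s = ((fine (mu U))^-1 * \1_U s)%:C} ->
  (forall s, U s -> c <= complex.Re (phi pi x v s)) ->
  c <= complex.Re '[t, tens HH v x].
Proof.
move=> oU /andP[mU0 mUoo] c0; set m := fine (mu U) => tm tf Uc.
have mU : measurable (U : set (borel Sigma)) by exact: open_borel.
have m0 : 0 < m by rewrite fine_gt0// mU0.
set y := tens HH v x.
have [_ _ _ Pt] := PhiP.
have IP := Phi_integrable PhiP.
pose a (s : Sigma) : R := 2 * c * m^-1 * \1_U s.
have iU : mu.-integrable setT (EFin \o (\1_U : borel Sigma -> R)).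
  apply: ge0_integrable; first exact: measurable_indic.
    by move=> s; rewrite indicE.
  by rewrite integral_indic// setIT.
have ia : mu.-integrable setT (EFin \o (a : borel Sigma -> R)).
  exact: (integrableZl _ (2 * c * m^-1) iU).
have Ia : \int[mu]_s a s = 2 * c.
  rewrite RintegralZl// /Rintegral integral_indic// setIT -/m.
  by rewrite divfK// gt_eqF.
have : \int[mu]_s (sq (Phi (t - y)) s + a s) <=
    \int[mu]_s (sq (Phi t) s + sq (Phi y) s).
  rewrite /Rintegral fine_le//.
  - apply: integrable_fin_num => //; exact: (integrableD _ (IP _) ia).
  - apply: integrable_fin_num => //; exact: (integrableD _ (IP _) (IP _)).
  apply: ae_ge0_le_integral => //.
  - by move=> s _; rewrite lee_fin addr_ge0 ?sq_ge0// !mulr_ge0 ?invr_ge0 ?(ltW m0)// indicE.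
  - by have /integrableP[] := integrableD measurableT (IP (t - y)) ia.
  - by move=> s _; rewrite lee_fin addr_ge0 ?sq_ge0.
  - by have /integrableP[] := integrableD measurableT (IP t) (IP y).
  have := ae_mono2 (fun s => @conj _ _) tf (Pt v x).
  move: (Phi_sub PhiP t y); apply: ae_mono2 => s ts [ft fy] _.
  rewrite lee_fin /sq ts -/y ft fy /a indicE.
  have [sU|_] := boolP (s \in U) => /=.
    rewrite !mulr1; set z := phi pi x v s.
    have zc : c <= complex.Re z by apply: Uc; exact: set_mem.
    rewrite !rnorm_complex_sqr /=.
    have : m^-1 * c <= m^-1 * complex.Re z by rewrite ler_pM2l ?invr_gt0.
    case: z zc => p q /= _; rewrite expr0n/= sub0r sqrrN; lra.
  by rewrite !mulr0 sub0r rnormN addr0 lerDr sqr_ge0.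
rewrite !RintegralD// Ia !(Rintegral_Phi PhiP) rnormB_sqr mulr2n; lra.
Qed.

(** Near s1 the operators pi(s)^* almost fix the images of the unit ball, hence so
    does their average over a small neighbourhood of s1, which is close to an
    operator of finite rank. Instead of comparing operators, the residual
    v = x - P x is paired with x: the average gives almost |v|^2, the finite-rank
    operator gives 0. *)
Lemma equicontinuous_nearly_finite_dim K (M : R) (s1 : Sigma) :
  adjoint (pi s1) = bop_id H -> measure_support mu s1 ->
  (forall S, K S -> rnorm S <= M) ->
  equicontinuous K (fun S (s : Sigma) => adjoint (pi s) \oB S) ->
  nearly_finite_dim (unit_images K).
Proof.
move=> pi1 sup KM /equicontinuous_rnormP Keq e e0.
have e20 : 0 < e / 2 by rewrite divr_gt0.
have M1 : 0 < `|M| + 1 by rewrite ltr_wpDl.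
have [U [oU UK mU]] := support_open_neighbourhood sup (Keq s1 _ e20).
have [t tm tf] := indicator_tensor oU mU.
have [|l tl] := finite_tensor_approx t (e := e / 2 / (`|M| + 1)).
  by rewrite divr_gt0.
have [es o esP] := gram_schmidt [seq p.1 | p <- l].
exists es => // _ [S [u [KS u1 ->]]]; set x := S u; set v := x - _.
have xM : rnorm x <= `|M| + 1.
  rewrite (le_trans (bop_le_ball _ u1))// (le_trans (KM _ KS))//.
  by rewrite (le_trans (ler_norm M))// lerDl.
have [ve|ve] := lerP (rnorm v) (e / 2); first by lra.
have v0 : 0 < rnorm v by exact: lt_trans ve.
pose c := rnorm v ^+ 2 - e / 2 * rnorm v.
have c0 : 0 <= c by rewrite /c expr2 -mulrBl mulr_ge0 ?(ltW v0)// subr_ge0 ltW.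
have ct : c <= complex.Re '[t, tens HH v x].
  apply: average_inner oU mU c0 tm tf _.
  move=> s Us; rewrite phiE.
  rewrite -(subrK x (adjoint (pi s) x)) innerDr ReD.
  have -> : complex.Re '[v, x] = rnorm v ^+ 2.
    by rewrite innerC ReJ sub_projection_sqr.
  rewrite /c [leRHS]addrC lerD2l lerNl -ReN -innerNr opprB.
  rewrite (le_trans (Re_le_rnorm _))// (le_trans (cauchy_schwarz _ _))// mulrC.
  rewrite ler_wpM2r ?rnorm_ge0//.
  have := UK _ Us _ KS; rewrite pi1 => /ltW; apply: le_trans.
  exact: (bop_le_ball ((bop_id H \oB S) - (adjoint (pi s) \oB S)) u1).
have t'0 : '[finite_tensor HH l, tens HH v x] = 0.
  rewrite /finite_tensor inner_suml big_seq big1// => p pl.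
  have vp : '[v, p.1] = 0.
    by apply: esP; [exact: sub_projection_perp|exact: map_f].
  by rewrite inner_tensor (innerC p.1) vp rmorph0 mul0r.
have : c <= e / 2 * rnorm v.
  apply: le_trans ct _; rewrite -[X in complex.Re X]subr0 -t'0 -innerBl.
  rewrite (le_trans (Re_le_rnorm _))// (le_trans (cauchy_schwarz _ _))//.
  rewrite rnorm_tensor mulrCA mulrC ler_wpM2r ?rnorm_ge0//.
  apply: (@le_trans _ _ (e / 2 / (`|M| + 1) * (`|M| + 1))).
    by rewrite ler_pM ?rnorm_ge0// ltW.
  by rewrite divfK// gt_eqF.
rewrite /c lerBlDr -mulrDl -splitr expr2 ler_pM2r//.
Qed.

End averaging.

(** * The equivalences *)

Lemma bounded_set_rnorm {R : realType} (V : normedModType R[i]) (K : set V) :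
  bounded_set K -> exists M : R, forall x, K x -> rnorm x <= M.
Proof.
move=> [M [/complex_realP[m ->] KM]]; exists (m + 1) => x Kx.
by rewrite -rnorm_le; apply: (KM (m + 1)%:C) => //; rewrite ltcR ltrDl.
Qed.

Theorem corollary5p3 (R : realType) (H : hilbertType R)
  (H_separable : separable H)
  (Sigma : ptopologicalType)
  (Sigma_hausdorff : hausdorff_space Sigma)
  (Sigma_lc : locally_compact [set: Sigma])
  (Sigma_sc : sigma_compact Sigma)
  (mu : {measure set (borel Sigma) -> \bar R})
  (mu_radon : radon_measure mu)
  (pi : Sigma -> 'B(H))
  (pi_square_integrable : forall u v : H,
    (\int[mu]_s (rnorm '[pi s u, v] ^+ 2)%:E
      = (rnorm u ^+ 2 * rnorm v ^+ 2)%:E)%E)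
  (pi_strongly_continuous : forall u : H,
    continuous (fun s : Sigma => adjoint (pi s) u))
  (HH : hilbert_tensor H (conjugate H))
  (Phi : HH -> Sigma -> R[i])
  (PhiP : is_Phi mu pi Phi)
  (Phi_surjective : L2_surjective mu Phi)
  (pi_unit : exists2 s1 : Sigma,
    adjoint (pi s1) = bop_id H & measure_support mu s1)
  (Lambda : {linear HH -> 'B(H)})
  (LambdaP : is_Lambda Lambda)
  (K : set 'B(H))
  (K_bounded : bounded_set K) :
  [<-> precompact K /\ (forall S, K S -> compact_operator S);
       exists2 w : H, w != 0 & uniformly_tight mu pi w (with_adjoints K);
       forall w : H, uniformly_tight mu pi w (with_adjoints K);
       forall eps : R, 0 < eps -> exists2 f : Sigma -> R[i], Cc f &
         (ereal_sup [set (rnorm ((Pi mu Phi Lambda f - bop_id H) \oB S))%:E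
                    | S in with_adjoints K] <= eps%:E)%E;
       equicontinuous (with_adjoints K)
         (fun S (s : Sigma) => adjoint (pi s) \oB S)].
Proof.
have [mu_compact _ _] := mu_radon.
have [s1 pi_s1 s1_supp] := pi_unit.
have [M KM] := bounded_set_rnorm K_bounded.
have K'M S : with_adjoints K S -> rnorm S <= M.
  by move=> [/KM//|[T /KM TM <-]]; rewrite rnorm_adjoint.
set X := unit_images (with_adjoints K).
have XM x : X x -> rnorm x <= M.
  by move=> [S [u [/K'M SM u1 ->]]]; exact: le_trans (bop_le_ball _ u1) SM.
have tb := nearly_finite_dim_totally_bounded XM.
have tightP w := uniformly_tightP Sigma_hausdorff pi_square_integrable
  pi_strongly_continuous w (with_adjoints K).
have compact_tb : precompact K /\ (forall S, K S -> compact_operator S) <->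
    totally_bounded X.
  split=> [[Kp Kc]|Xtb]; first exact: precompact_totally_bounded_images.
  split; first exact: totally_bounded_images_precompact.
  by move=> S KS; apply: totally_bounded_images_compact Xtb _; left.
have tb_tight : totally_bounded X ->
    forall w, uniformly_tight mu pi w (with_adjoints K).
  by move=> Xtb w; apply/tightP; exact: totally_bounded_tight.
have tight_tb : (exists2 w : H, w != 0 &
    uniformly_tight mu pi w (with_adjoints K)) -> totally_bounded X.
  move=> [w w0 /tightP Kw]; apply: tb.
  exact: (tight_nearly_finite_dim Sigma_hausdorff mu_compact
    pi_square_integrable pi_strongly_continuous w0 XM Kw).
have [w w0] : exists w : H, w != 0.
  exact: (nontrivial_space Sigma_hausdorff Sigma_lc mu_compact PhiP
    Phi_surjective s1_supp).
tfae.
- by move=> /compact_tb/tb_tight Kw; exists w.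
- by move=> /tight_tb; exact: tb_tight.
- move=> Kw; apply: (nearly_finite_dim_symbol Sigma_hausdorff Sigma_lc Sigma_sc
    mu_compact pi_strongly_continuous PhiP Phi_surjective LambdaP K'M).
  by apply: totally_bounded_nearly_finite_dim; apply: tight_tb; exists w.
- move=> /(symbol_nearly_finite_dim LambdaP K'M)/tb.
  exact: totally_bounded_equicontinuous.
- move=> Keq; apply/compact_tb/tb.
  exact: (equicontinuous_nearly_finite_dim Sigma_hausdorff Sigma_lc mu_compact
    PhiP Phi_surjective pi_s1 s1_supp K'M Keq).
Qed.
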